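(* Let $\mathcal{O}=\mathcal{O}_f$ be an order in a quadratic number field $K$ with conductor $\mathfrak{f}=f\mathcal{O}_K$ for some integer $f\geq 2$, let $p$ be a prime divisor of $f$, and let $\mathfrak{p}=P_{f,p}=p\mathbb{Z}+f\omega\mathbb{Z}$. 1. The primary ideals of $\mathcal{O}$ with radical $\mathfrak{p}$ are exactly the ideals of the form $\mathfrak{q}=p^\ell(p^m\mathbb{Z}+(r+\tau)\mathbb{Z})$ with $\ell,m\in\mathbb{N}_0$, $\ell+m\geq 1$, $0\leq r<p^m$ ($r$ an integer), and $\mathcal{N}_{K/\mathbb{Q}}(r+\tau)\equiv 0\bmod p^m$. Moreover, $\mathcal{N}(\mathfrak{q})=p^{2\ell+m}$. 2. A primary ideal $\mathfrak{q}=p^\ell(p^m\mathbb{Z}+(r+\tau)\mathbb{Z})$ is invertible if and only if $\mathcal{N}_{K/\mathbb{Q}}(r+\tau)\not\equiv 0\bmod p^{m+1}$. 3. A primary ideal $\mathfrak{q}$ with radical $\mathfrak{p}$ is an ideal atom if and only if $\mathfrak{q}=p\mathcal{O}$ or $\mathfrak{q}=p^m\mathbb{Z}+(r+\tau)\mathbb{Z}$ with $m\in\mathbb{N}$ and $p^m\mid\mathcal{N}_{K/\mathbb{Q}}(r+\tau)$. 4. For $m\in\mathbb{N}$, let $n_m$ be the number of invertible ideal atoms of the form $p^m\mathbb{Z}+(r+\tau)\mathbb{Z}$ with norm $p^m$. Put $v=\mathrm{v}_p(f)$. Then: - if $m=2h$ with $1\le h<v$, then $n_m=\varphi(p^{m/2})$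 (whether $p$ is inert, ramified or split); - if $m=2v$, then $n_m=p^{v}$ if $p$ is inert, $n_m=\varphi(p^{m/2})=\varphi(p^{v})$ if $p$ is ramified, and $n_m=p^{v-1}(p-2)$ if $p$ splits; - if $m=2v+1$, then $n_m=0$ if $p$ is inert, $n_m=p^{v}$ if $p$ is ramified, and $n_m=2\varphi(p^{v})$ if $p$ splits; - if $m>2v+1$, then $n_m=0$ if $p$ is inert or ramified, and $n_m=2\varphi(p^{v})$ if $p$ splits; - for all other $m$ (i.e. $m$ odd with $m<2v$), $n_m=0$. 5. The number of ideal atoms with radical $\mathfrak{p}$ is finite if and only if the number of invertible ideal atoms with radical $\mathfrak{p}$ is finite, if and only if $p$ does not split.
   Context: Let $d\in\mathbb{Z}\setminus\{0,1\}$ be squarefree, $K=\mathbb{Q}(\sqrt d)$, with ring of integers $\mathcal{O}_K=\mathbb{Z}[\omega]$, where $\omega=\sqrt d$ and $d_K=4d$ if $d\equiv 2,3\bmod 4$, and $\omega=\frac{1+\sqrt d}{2}$ and $d_K=d$ if $d\equiv 1\bmod 4$. For $f\in\mathbb{N}$ let $\varepsilon\in\{0,1\}$ with $\varepsilon\equiv fd_K\bmod 2$, $\eta=\frac{\varepsilon-f^2d_K}{4}$, $\tau=\frac{\varepsilon+f\sqrt{d_K}}{2}$. Then $\mathcal{O}_f=\mathbb{Z}\oplus f\omega\mathbb{Z}=\mathbb{Z}\oplus\tau\mathbb{Z}$ is the order in $K$ with conductor $f\mathcal{O}_K$ (every order in $K$ has this form), and $\mathcal{N}_{K/\mathbb{Q}}(r+\tau)=r^2+\varepsilon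 r+\eta$ for $r\in\mathbb{Z}$, where $\mathcal{N}_{K/\mathbb{Q}}$ is the field norm. $\mathbb{N}$ is the set of positive integers and $\mathbb{N}_0=\mathbb{N}\cup\{0\}$. For a nonzero ideal $I$ of $\mathcal{O}$, $\mathcal{N}(I)=|\mathcal{O}/I|$. An ideal atom of $\mathcal{O}$ is an atom of the multiplicative monoid of nonzero ideals of $\mathcal{O}$, i.e. a proper nonzero ideal that is not a product of two proper ideals. $\mathrm{v}_p$ is the $p$-adic valuation and $\varphi$ is Euler's function. A prime $p$ is inert, split, or ramified according to whether $p\mathcal{O}_K$ is a prime ideal, a product of two distinct prime ideals, or the square of a prime ideal of $\mathcal{O}_K$.
   Formalization: In item 2 the printed criterion fails for m = 0 (e.g. d = 2, f = p = 3: q = 3O is principal, but N(τ) = −18 is divisible by 3); the formal version states that q is always invertible when m = 0 and keeps the printed equivalence for m ≥ 1. *)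

(* Defs.v *)
From HB Require Import structures.
From mathcomp Require Import all_boot all_order all_algebra all_field.
From mathcomp Require Import boolp classical_sets functions cardinality.

Set Implicit Arguments.
Unset Strict Implicit.
Unset Printing Implicit Defensive.

Import Order.TTheory GRing.Theory Num.Theory.

Local Open Scope classical_set_scope.
Local Open Scope card_scope.
Local Open Scope ring_scope.

(* Orders are subsets O of the ambient field F, and their ideals are subsets
   of F as well, so that ideals of O and of the maximal order are handled by
   the same definitions. *)
Section Ideals.
Variables (F : fieldType) (O : set F).

Definition is_ideal (I : set F) : Prop :=
  [/\ I `<=` O, I 0,
      forall x y, I x -> I y -> I (x + y)
    & forall a x, O a -> I x -> I (a * x)].

Definition ideal_radical (I : set F) : set F :=
  [set x | O x /\ exists2 n : nat, (0 < n)%N & I (x ^+ n)].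

Definition prime_ideal (I : set F) : Prop :=
  [/\ is_ideal I, I <> O
    & forall a b, O a -> O b -> I (a * b) -> I a \/ I b].

Definition primary_ideal (I : set F) : Prop :=
  [/\ is_ideal I, I <> O
    & forall a b, O a -> O b -> I (a * b) -> I a \/ ideal_radical I b].

Definition ideal_mul (I J : set F) : set F :=
  [set x | exists (n : nat) (a b : 'I_n -> F),
     [/\ forall i, I (a i), forall i, J (b i) & x = \sum_(i < n) a i * b i]].

(* (O : I), taken in F; F is meant to be the field of fractions of O. *)
Definition ideal_inv (I : set F) : set F :=
  [set x | forall y, I y -> O (x * y)].

Definition invertible_ideal (I : set F) : Prop :=
  is_ideal I /\ ideal_mul I (ideal_inv I) = O.

Definition ideal_atom (I : set F) : Prop :=
  [/\ is_ideal I, I <> [set 0], I <> O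
    & forall J1 J2, is_ideal J1 -> is_ideal J2 -> I = ideal_mul J1 J2 ->
        J1 = O \/ J2 = O].

(* |O / I| = n, the elements of O / I being the cosets a + I with a in O. *)
Definition ideal_norm_is (I : set F) (n : nat) : Prop :=
  [set [set a + x | x in I] | a in O] #= `I_n.

(* n O *)
Definition principal_nat (n : nat) : set F := [set n%:R * x | x in O].

End Ideals.

Definition squarefree_int (d : int) : Prop :=
  forall q : nat, prime q -> ~~ ((q ^ 2)%N%:Z %| d)%Z.

Section QuadraticField.
(* A quadratic field is normal over rat, so that asking for a splittingFieldType
   is not a restriction; it makes the library's galNorm available. The element
   s is the chosen square root of d. *)
Variables (K : splittingFieldType rat) (d : int) (s : K) (f : nat).

Definition quadratic_field : Prop :=
  [/\ d != 0, d != 1, squarefree_int d, s ^+ 2 = d%:~R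
    & <<1; s>>%VS = fullv].

Definition d_K : int := if (d %% 4 == 1)%Z then d else 4 * d.

Definition sqrt_d_K : K := if (d %% 4 == 1)%Z then s else 2 * s.

Definition omega : K := if (d %% 4 == 1)%Z then (1 + s) / 2 else s.

Definition epsilon : int := ((f%:Z * d_K) %% 2)%Z.

Definition tau : K := (epsilon%:~R + f%:R * sqrt_d_K) / 2.

Definition O_K : set K := [set x | integralOver (intr : int -> K) x].

Definition O_f : set K :=
  [set a%:~R + b%:~R * (f%:R * omega) | a in [set: int] & b in [set: int]].

Definition P_f (p : nat) : set K :=
  [set p%:R * a%:~R + b%:~R * (f%:R * omega)
     | a in [set: int] & b in [set: int]].

(* p^l (p^m Z + (r + tau) Z) *)
Definition lattice (p l m r : nat) : set K :=
  [set p%:R ^+ l * (p%:R ^+ m * a%:~R + (r%:R + tau) * b%:~R)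
     | a in [set: int] & b in [set: int]].

Definition fieldNorm (x : K) : K := galNorm 1 fullv x.

(* n divides N(r + tau) in Z; the norm is an integer seen in K. *)
Definition dvd_norm (n r : nat) : Prop :=
  exists z : int, fieldNorm (r%:R + tau) = n%:R * z%:~R.

Definition prime_inert (p : nat) : Prop := prime_ideal O_K (principal_nat O_K p).

Definition prime_splits (p : nat) : Prop :=
  exists P Q : set K, [/\ prime_ideal O_K P, prime_ideal O_K Q, P <> Q
    & principal_nat O_K p = ideal_mul P Q].

Definition prime_ramifies (p : nat) : Prop :=
  exists2 P : set K, prime_ideal O_K P
    & principal_nat O_K p = ideal_mul P P.

Definition invertible_atoms_of_norm (p m : nat) : set (set K) :=
  [set q | [/\ exists2 r : nat, (r < p ^ m)%N & q = lattice p 0 m r,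
      ideal_atom O_f q, invertible_ideal O_f q
    & ideal_norm_is O_f q (p ^ m)]].

End QuadraticField.

(* Main.v *)
Require Import Defs.
From HB Require Import structures.
From mathcomp Require Import all_boot all_order all_algebra all_field.
From mathcomp Require Import boolp classical_sets functions cardinality.
From mathcomp Require Import ring zify.

Set Implicit Arguments.
Unset Strict Implicit.
Unset Printing Implicit Defensive.

Import Order.TTheory GRing.Theory Num.Theory.

Local Open Scope classical_set_scope.
Local Open Scope card_scope.
Local Open Scope ring_scope.

(** The ring Z[th] is kept abstract because it is needed twice: with th = f omega for the ideals of
    the order, and with th = omega for the decomposition of p in the maximal order. Both questions
    then turn on one polynomial X^2 + t0 X + n0, whose value at a is the norm of a + omega: inert
    primes give no root modulo p, ramified primes a double root, split primes two simple roots. The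
    three behaviours above valuation 2 v have different origins. Without a root the norm form is
    anisotropic modulo p, so 2 v is never exceeded. At a double root one further factor p appears
    and no more, because Z[omega] is integrally closed. Simple roots lift by Hensel, so that every
    valuation above 2 v occurs; this is the source of the infinitely many atoms. *)

(* Write O_f = Z[th] with th = f omega, th^2 = t th - n; since p | f we have
   p | t and p^2 | n. Then P_f = { u + v th : p | u } contains every proper
   ideal containing a power of p, because the norm of u + v th is congruent to
   u^2 modulo p; and P_f^2 is contained in p P_f, so that a product of two
   such ideals contains neither p nor any r + tau: this gives the atoms. An
   ideal containing a power of p is brought to Hermite normal form. The ideal
   I = p^m Z + (c + th) Z, with p^m dividing N(c + th), is invertible when p
   does not divide N(c + th) / p^m, by multiplying it by its conjugate;
   otherwise (c + th) / p stabilises I and is not in O_f.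
   Counting invertible atoms means counting the r < p^m with p^m exactly
   dividing N(c + th) = c^2 + t c + n, c = r - r0. If v_p(c) = h < v this norm
   has valuation 2h, and if c = p^v u it is p^(2v) times a quadratic form in u
   whose roots modulo p reflect the decomposition of p in O_K = Z[omega]. *)

(** * Primary ideals of a quadratic order *)

Lemma prime_coprimez (p : nat) (x : int) :
  prime p -> coprimez p x = ~~ (p%:Z %| x)%Z.
Proof. by move=> pP; rewrite coprimezE absz_nat prime_coprime // dvdzE. Qed.

Lemma prime_dvdzM (p : nat) (x y : int) :
  prime p -> (p%:Z %| x * y)%Z = (p%:Z %| x)%Z || (p%:Z %| y)%Z.
Proof. by move=> pP; rewrite !dvdzE abszM absz_nat Euclid_dvdM. Qed.

Lemma prime_dvdzX (p : nat) (x : int) (k : nat) :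
  prime p -> (p%:Z %| x ^+ k)%Z = (p%:Z %| x)%Z && (0 < k)%N.
Proof. by move=> pP; rewrite !dvdzE abszX absz_nat Euclid_dvdX. Qed.

Lemma prime_neq0z (p : nat) : prime p -> p%:Z != 0.
Proof. by move=> /prime_gt0; case: p. Qed.

Lemma dvdz_add (d x y : int) : (d %| x)%Z -> (d %| y)%Z -> (d %| x + y)%Z.
Proof. exact: rpredD. Qed.

Lemma dvdz_sub (d x y : int) : (d %| x)%Z -> (d %| y)%Z -> (d %| x - y)%Z.
Proof. exact: rpredB. Qed.

Lemma dvdz_addl (d x y : int) : (d %| y)%Z -> (d %| x + y)%Z = (d %| x)%Z.
Proof. exact: rpredDr. Qed.

Lemma int_mod_nat (A : nat) (x : int) :
  (0 < A)%N -> exists2 a : nat, (a < A)%N & (A%:Z %| x - a%:Z)%Z.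
Proof.
move=> A0; have A0' : A%:Z != 0 by case: A A0.
exists `|(x %% A)%Z|%N.
  by rewrite -ltz_nat gez0_abs ?modz_ge0 // ltz_pmod // ltz_nat.
rewrite gez0_abs ?modz_ge0 // {1}(divz_eq x A) addrK dvdz_mull //.
Qed.

Lemma small_dvdz_eq (A a b : nat) :
  (a < A)%N -> (b < A)%N -> (A%:Z %| a%:Z - b%:Z)%Z -> a = b.
Proof.
by move=> aA bA; rewrite -eqz_mod_dvd !modz_nat !modn_small // eqz_nat => /eqP.
Qed.

Lemma prime_coprimezX (p k : nat) (x : int) :
  prime p -> ~~ (p%:Z %| x)%Z -> coprimez (p%:Z ^+ k) x.
Proof. by move=> pP px; apply: coprimezXl; rewrite prime_coprimez. Qed.

Lemma gcdz_primeX (p k : nat) (x : int) : prime p ->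
  exists2 j, (j <= k)%N & gcdz x (p%:Z ^+ k) = p%:Z ^+ j.
Proof.
move=> pP; have : (gcdn `|x| (p ^ k) %| p ^ k)%N by apply: dvdn_gcdr.
case/(dvdn_pfactor _ _ pP) => j jk e; exists j => //.
by rewrite /gcdz abszX absz_nat e -rmorphXn.
Qed.

(** * Products of ideals and containments *)

Section IdealProducts.
Variables (F : fieldType) (O : set F).

Lemma mem_ideal_mul2 (I J : set F) (a b a' b' : F) :
  I a -> J b -> I a' -> J b' -> ideal_mul I J (a * b + a' * b').
Proof.
move=> Ia Jb Ia' Jb'.
exists 2%N, (fun i => if i == 0 then a else a'), (fun i => if i == 0 then b else b').
split; try by move=> i; case: ifP.
by rewrite big_ord_recr big_ord1.
Qed.

Lemma ideal_mul_sub (I J S : set F) :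
  S 0 -> (forall x y, S x -> S y -> S (x + y)) ->
  (forall x y, I x -> J y -> S (x * y)) -> ideal_mul I J `<=` S.
Proof.
move=> S0 SD SM x [n [a [b [Ia Jb ->]]]].
by apply: (big_ind S) => // i _; apply: SM.
Qed.

Lemma ideal_eq_unit (I : set F) : is_ideal O I -> I 1 -> I = O.
Proof.
move=> [IO _ _ IM] I1; apply/seteqP; split=> // x Ox.
by rewrite -[x]mulr1; apply: IM.
Qed.

Lemma ideal_mul_subl (I J : set F) : is_ideal O I -> is_ideal O J -> ideal_mul I J `<=` I.
Proof.
move=> [IO I0 ID IM] [JO _ _ _]; apply: ideal_mul_sub => // x y Ix Jy.
by rewrite mulrC; apply: IM => //; apply: JO.
Qed.

Lemma ideal_mul_subr (I J : set F) : is_ideal O I -> is_ideal O J -> ideal_mul I J `<=` J.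
Proof.
move=> [IO _ _ _] [JO J0 JD JM]; apply: ideal_mul_sub => // x y Ix Jy.
by apply: JM => //; apply: IO.
Qed.

End IdealProducts.

Section QuadraticOrder.
Variables (K : fieldType) (th : K) (t n : int).
Hypothesis thE : th ^+ 2 = t%:~R * th - n%:~R.
Hypothesis th_free : forall a b : int, a%:~R + b%:~R * th = 0 -> a = 0 /\ b = 0.

Definition elt (a b : int) : K := a%:~R + b%:~R * th.

Definition qorder : set K :=
  [set a%:~R + b%:~R * th | a in [set: int] & b in [set: int]].

(** The norm form of Z[th], [th] having trace [t] and norm [n]; in particular [qform c 1] is the
    norm of c + th. *)
Definition qform (a b : int) : int := a ^+ 2 + t * a * b + n * b ^+ 2.

Lemma eltD a b a' b' : elt a b + elt a' b' = elt (a + a') (b + b').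
Proof. by rewrite /elt; ring. Qed.

Lemma eltB a b a' b' : elt a b - elt a' b' = elt (a - a') (b - b').
Proof. by rewrite /elt; ring. Qed.

Lemma eltM a b a' b' :
  elt a b * elt a' b' = elt (a * a' - n * b * b') (a * b' + b * a' + t * b * b').
Proof. by rewrite /elt; ring: thE. Qed.

Lemma eltZ k a b : k%:~R * elt a b = elt (k * a) (k * b).
Proof. by rewrite /elt; ring. Qed.

Lemma elt_int k : elt k 0 = k%:~R.
Proof. by rewrite /elt; ring. Qed.

Lemma elt_inj a b a' b' : elt a b = elt a' b' -> a = a' /\ b = b'.
Proof.
move=> /eqP; rewrite -subr_eq0 eltB => /eqP /th_free[].
by move=> /eqP; rewrite subr_eq0 => /eqP-> /eqP; rewrite subr_eq0 => /eqP->.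
Qed.

Lemma qorder_intr_inj (a b : int) : a%:~R = b%:~R :> K -> a = b.
Proof. by rewrite -!elt_int => /elt_inj[]. Qed.

Lemma qorder_intr_eq0 (a : int) : (a%:~R == 0 :> K) = (a == 0).
Proof. by apply/eqP/eqP => [/(qorder_intr_inj (b := 0))|->]. Qed.

Lemma qorderP x : qorder x <-> exists a b, x = elt a b.
Proof.
split; first by case=> a _ [b _ <-]; exists a, b.
by case=> a [b ->]; exists a => //; exists b.
Qed.

Lemma qorder_elt a b : qorder (elt a b).
Proof. by apply/qorderP; exists a, b. Qed.

Lemma qorder_int a : qorder a%:~R.
Proof. by rewrite -elt_int; apply: qorder_elt. Qed.

Lemma qorder_nat a : qorder a%:R.
Proof. exact: (qorder_int a). Qed.

Lemma qorderM x y : qorder x -> qorder y -> qorder (x * y).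
Proof.
move=> /qorderP[a [b ->]] /qorderP[a' [b' ->]].
by rewrite eltM; apply: qorder_elt.
Qed.

Lemma qorderD x y : qorder x -> qorder y -> qorder (x + y).
Proof.
move=> /qorderP[a [b ->]] /qorderP[a' [b' ->]].
by rewrite eltD; apply: qorder_elt.
Qed.

(* [elt (a + t b) (- b)] is the conjugate of [elt a b]. *)
Lemma elt_conjM a b : elt a b * elt (a + t * b) (- b) = (qform a b)%:~R.
Proof. by rewrite /elt /qform; ring: thE. Qed.

Lemma ideal_intM (I : set K) k x : is_ideal qorder I -> I x -> I (k%:~R * x).
Proof. by case=> _ _ _ IM Ix; apply: IM => //; apply: qorder_int. Qed.

Lemma idealB (I : set K) x y : is_ideal qorder I -> I x -> I y -> I (x - y).
Proof.
move=> idI Ix Iy; have [_ _ ID _] := idI; apply: ID => //.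
by have -> : - y = (-1)%:~R * y; [ring|apply: ideal_intM].
Qed.

Lemma ideal_coprime_eq (I : set K) (x y : int) :
  is_ideal qorder I -> I x%:~R -> I y%:~R -> coprimez x y -> I = qorder.
Proof.
move=> idI Ix Iy /eqP xy; apply: ideal_eq_unit => //.
have [u [w e]] := Bezoutz x y; have [_ _ ID _] := idI.
have -> : 1 = u%:~R * x%:~R + w%:~R * y%:~R :> K.
  by rewrite -!intrM -intrD e xy.
by apply: ID; apply: ideal_intM.
Qed.

Lemma ideal_norm (I : set K) a b :
  is_ideal qorder I -> I (elt a b) -> I (qform a b)%:~R.
Proof.
move=> [_ _ _ IM] Iab; rewrite -elt_conjM mulrC; apply: IM => //.
exact: qorder_elt.
Qed.

Lemma coset_eqP (I : set K) x y : is_ideal qorder I ->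
  [set x + z | z in I] = [set y + z | z in I] <-> I (x - y).
Proof.
move=> idI; have [_ I0 ID _] := idI.
split=> [e|Ixy].
  have : [set x + z | z in I] x by exists 0; rewrite ?addr0.
  by rewrite e => -[z Iz <-]; rewrite addrAC subrr add0r.
have Iyx : I (y - x) by rewrite -opprB -sub0r; apply: idealB.
apply/seteqP; split=> w [z Iz <-].
  by exists (x - y + z); [exact: ID|ring].
by exists (y - x + z); [exact: ID|ring].
Qed.

Section Prime.
Variables (p : nat).
Hypothesis p_prime : prime p.

Lemma pK_neq0 k : (p%:R : K) ^+ k != 0.
Proof.
by rewrite expf_neq0 // -[p%:R]/(p%:Z%:~R) qorder_intr_eq0 prime_neq0z.
Qed.

Lemma pK_int k : (p%:R : K) ^+ k = (p%:Z ^+ k)%:~R.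
Proof. by rewrite rmorphXn. Qed.

Lemma principal_natP u v :
  principal_nat qorder p (elt u v) <-> (p%:Z %| u)%Z /\ (p%:Z %| v)%Z.
Proof.
split=> [[x /qorderP[a [b ->]]]|[/dvdzP[a ->] /dvdzP[b ->]]].
  rewrite -[p%:R]/(p%:Z%:~R) eltZ => /elt_inj[<- <-].
  by rewrite !dvdz_mulr.
exists (elt a b); first exact: qorder_elt.
by rewrite -[p%:R]/(p%:Z%:~R) eltZ ![_ * p%:Z]mulrC.
Qed.

Lemma principal_nat_p : principal_nat qorder p p%:R.
Proof. by exists 1; [exact: (qorder_int 1)|rewrite mulr1]. Qed.

(* For a root a of X^2 + t X + n modulo p, this is the kernel of the ring
   homomorphism from the order to F_p sending th to - a. *)
Definition root_ideal (a : int) : set K :=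
  [set x | exists u v : int, x = elt u v /\ (p%:Z %| u - v * a)%Z].

Lemma root_idealE a u v : root_ideal a (elt u v) <-> (p%:Z %| u - v * a)%Z.
Proof.
by split=> [[u' [v' [/elt_inj[-> ->]]]]|]; last by exists u, v.
Qed.

Lemma root_ideal_prime a : (p%:Z %| qform a 1)%Z -> prime_ideal qorder (root_ideal a).
Proof.
move=> pa.
have key u v u' v' : (p%:Z %| u * u' - n * v * v' -
    (u * v' + v * u' + t * v * v') * a)%Z = (p%:Z %| u - v * a)%Z || (p%:Z %| u' - v' * a)%Z.
  rewrite -prime_dvdzM //.
  have -> : (u - v * a) * (u' - v' * a) = u * u' - n * v * v' -
    (u * v' + v * u' + t * v * v') * a + v * v' * qform a 1 by rewrite /qform; ring.
  by rewrite [RHS]dvdz_addl // dvdz_mull.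
split; first split.
- by move=> x [u [v [-> _]]]; apply: qorder_elt.
- by rewrite -[0](elt_int 0); apply/root_idealE; rewrite mul0r subr0 dvdz0.
- move=> x y [u [v [-> puv]]] [u' [v' [-> puv']]].
  rewrite eltD; apply/root_idealE.
  by rewrite mulrDl opprD addrACA; apply: dvdz_add.
- move=> x y /qorderP[u [v ->]] [u' [v' [-> puv']]].
  by rewrite eltM; apply/root_idealE; rewrite key puv' orbT.
- move=> eqO; have : root_ideal a 1 by rewrite eqO; apply: (qorder_int 1).
  rewrite -[1](elt_int 1) => /root_idealE; rewrite mul0r subr0.
  by rewrite dvdzE /= dvdn1; case: p p_prime => [|[|]].
- move=> x y /qorderP[u [v ->]] /qorderP[u' [v' ->]].
  by rewrite eltM => /root_idealE; rewrite key => /orP[] ?; [left|right]; apply/root_idealE.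
Qed.

Lemma root_ideal_p a : root_ideal a p%:R.
Proof. by exists p%:Z, 0; rewrite elt_int mul0r subr0 dvdzz. Qed.

(** * Lattices in Hermite normal form *)

Definition lat (l m : nat) (c : int) : set K :=
  [set p%:R ^+ l * (p%:R ^+ m * a%:~R + (c%:~R + th) * b%:~R)
     | a in [set: int] & b in [set: int]].

(** In the basis 1, c + th the element u + v th has coordinates u - c v and v. Questions about
    lattices are reduced to these two divisibilities. *)
Lemma lat_elt l m c u v :
  lat l m c (elt u v) <-> (p%:Z ^+ l %| v)%Z /\ (p%:Z ^+ (l + m) %| u - c * v)%Z.
Proof.
have E a b : p%:R ^+ l * (p%:R ^+ m * a%:~R + (c%:~R + th) * b%:~R) =
    elt (p%:Z ^+ (l + m) * a + c * (p%:Z ^+ l * b)) (p%:Z ^+ l * b).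
  by rewrite !pK_int exprD /elt; ring.
split=> [[a _ [b _]]|[/dvdzP[b ->] /dvdzP[a e]]].
  by rewrite E => /elt_inj[<- <-]; rewrite addrK !dvdz_mulr.
exists a => //; exists b => //; rewrite E.
congr elt; last by ring.
by rewrite -[u](subrK (c * (b * p%:Z ^+ l))) e; ring.
Qed.

Lemma lat_qorder l m c : lat l m c `<=` qorder.
Proof.
move=> x [a _ [b _ <-]]; rewrite !pK_int; apply: qorderM; first exact: qorder_int.
apply: qorderD; first by apply: qorderM; apply: qorder_int.
apply: qorderM; last exact: qorder_int.
by rewrite -[X in _ + X]mul1r; apply: (qorder_elt c 1).
Qed.

Lemma lat_p l m c : lat l m c (p%:Z ^+ (l + m))%:~R.
Proof. by rewrite -elt_int; apply/lat_elt; rewrite mulr0 subr0 dvdz0 dvdzz. Qed.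

Lemma lat_gen l m c : lat l m c (elt (p%:Z ^+ l * c) (p%:Z ^+ l)).
Proof. by apply/lat_elt; rewrite mulrC subrr dvdz0 dvdzz. Qed.

Lemma lat_proper l m c : (1 <= l + m)%N -> lat l m c <> qorder.
Proof.
move=> lm eqO; have : lat l m c 1 by rewrite eqO; apply: (qorder_int 1).
rewrite -[1](elt_int 1) => /lat_elt[_]; rewrite mulr0 subr0.
rewrite dvdzE /= dvdn1 abszX absz_nat -(expn0 p) eqn_exp2l ?prime_gt1 //.
by case: (l + m)%N lm.
Qed.

(** The generator p^l (c + th) times the conjugate of c + th is the integer p^l N(c + th), and the
    integers of the lattice are the multiples of p^(l+m). *)
Lemma lat_idealP l m c :
  is_ideal qorder (lat l m c) <-> (p%:Z ^+ m %| qform c 1)%Z.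
Proof.
have pl0 : p%:Z ^+ l != 0 by rewrite expf_neq0 ?prime_neq0z.
split=> [idL|pc].
  have [_ _ _ IM] := idL.
  have := IM _ _ (qorder_elt (c + t * 1) (-1)) (lat_gen l m c).
  rewrite eltM => /lat_elt[_]; rewrite exprD.
  rewrite (_ : _ - _ = p%:Z ^+ l * qform c 1) ?dvdz_mul2l // /qform; ring.
split; first exact: lat_qorder.
- by rewrite -[0](elt_int 0); apply/lat_elt; rewrite mulr0 subr0 !dvdz0.
- move=> x y Lx Ly; have /qorderP[u [v xE]] := lat_qorder Lx.
  have /qorderP[u' [v' yE]] := lat_qorder Ly.
  move: Lx Ly; rewrite {}xE {}yE eltD => /lat_elt[h1 h2] /lat_elt[h3 h4].
  apply/lat_elt; split; first exact: dvdz_add.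
  by rewrite mulrDr opprD addrACA dvdz_add.
- move=> x y /qorderP[u [v ->]] Ly.
  have /qorderP[u' [v' yE]] := lat_qorder Ly.
  move: Ly; rewrite {}yE eltM => /lat_elt[h3 h4].
  have h5 : (p%:Z ^+ l %| u' - c * v')%Z by apply: dvdz_trans h4; rewrite exprD dvdz_mulr.
  apply/lat_elt; split.
    have -> : u * v' + v * u' + t * v * v' = v' * (u + t * v + v * c) + v * (u' - c * v') by ring.
    by apply: dvdz_add; [apply: dvdz_mulr|apply: dvdz_mull].
  (* u - c v is the value of u + v th at th = - c; this evaluation is multiplicative up to multiples
     of N(c + th). *)
  have -> : u * u' - n * v * v' - c * (u * v' + v * u' + t * v * v') =
            (u - c * v) * (u' - c * v') - v * (qform c 1 * v') by rewrite /qform; ring.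
  by apply: dvdz_sub; [|rewrite exprD [_ ^+ l * _]mulrC]; apply: dvdz_mull => //; apply: dvdz_mul.
Qed.

Lemma lat_neq0 l m c : lat l m c <> [set 0].
Proof.
move=> e; have := lat_p l m c; rewrite e /= => /eqP.
by rewrite qorder_intr_eq0 expf_eq0 (negPf (prime_neq0z p_prime)) andbF.
Qed.

(** The least power of p in the lattice is p^(l+m), which recovers m; the generator p^l (c + th)
    then compares c and c'. This is what makes counting ideals the same as counting residues. *)
Lemma lat_inj l m m' c c' : lat l m c = lat l m' c' ->
  m = m' /\ (p%:Z ^+ m %| c - c')%Z.
Proof.
have aux i j a b : lat l i a = lat l j b -> (j <= i)%N.
  move=> e; have := lat_p l i a; rewrite e -elt_int => /lat_elt[_].
  rewrite mulr0 subr0 dvdzE !abszX absz_nat dvdn_Pexp2l ?prime_gt1 //.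
  by rewrite leq_add2l.
move=> e; have em : m = m' by apply/eqP; rewrite eqn_leq (aux _ _ _ _ e) (aux _ _ _ _ (esym e)).
split=> //; have := lat_gen l m c; rewrite e -em => /lat_elt[_].
have -> : p%:Z ^+ l * c - c' * p%:Z ^+ l = p%:Z ^+ l * (c - c') by ring.
by rewrite exprD dvdz_mul2l // expf_neq0 ?prime_neq0z.
Qed.

Lemma lat_norm l m c : (p%:Z ^+ m %| qform c 1)%Z ->
  ideal_norm_is qorder (lat l m c) (p ^ (2 * l + m)).
Proof.
move=> /(lat_idealP l) idL.
set A := (p ^ (l + m))%N; set B := (p ^ l)%N.
have A0 : (0 < A)%N by rewrite expn_gt0 prime_gt0.
have B0 : (0 < B)%N by rewrite expn_gt0 prime_gt0.
have AE : p%:Z ^+ (l + m) = A%:Z by rewrite -rmorphXn.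
have BE : p%:Z ^+ l = B%:Z by rewrite -rmorphXn.
have -> : (p ^ (2 * l + m) = A * B)%N by rewrite -expnD; congr expn; lia.
(* In the basis 1, c + th the quotient is Z/A x Z/B; a pair of residues is encoded by the remainder
   and the quotient of [i] by [A]. *)
pose rep (i : nat) := elt ((i %% A)%N%:Z + c * (i %/ A)%N%:Z) (i %/ A)%N%:Z.
have repB i u v : lat l m c (elt u v - rep i) <->
    (B%:Z %| v - (i %/ A)%N%:Z)%Z /\ (A%:Z %| (u - c * v) - (i %% A)%N%:Z)%Z.
  rewrite eltB lat_elt AE BE.
  by rewrite (_ : _ - c * _ = u - c * v - (i %% A)%N%:Z) //; ring.
rewrite /ideal_norm_is (_ : [set _ | _ in qorder] =
    [set [set rep i + x | x in lat l m c] | i in `I_(A * B)]).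
  apply: inj_card_eq => i j; rewrite !inE /= => iN jN /(coset_eqP _ _ idL).
  move=> /repB[h1 h2]; rewrite (divn_eq i A) (divn_eq j A).
  have -> : (i %/ A = j %/ A)%N by apply: small_dvdz_eq h1; rewrite ltn_divLR // mulnC.
  congr (_ + _)%N; apply: (@small_dvdz_eq A); rewrite ?ltn_pmod //.
  by move: h2; rewrite addrK.
apply/seteqP; split=> [_ [x /qorderP[u [v ->]] <-]|_ [i _ <-]]; last first.
  by exists (rep i) => //; apply: qorder_elt.
have [a aA ha] := int_mod_nat (u - c * v) A0; have [b bB hb] := int_mod_nat v B0.
have ha' : ((b * A + a) %% A = a)%N by rewrite modnMDl modn_small.
have hb' : ((b * A + a) %/ A = b)%N by rewrite divnMDl // divn_small // addn0.
exists (b * A + a)%N => /=; first by nia.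
by apply/esym/(coset_eqP _ _ idL)/repB; rewrite ha' hb'.
Qed.

Lemma lat_mod l m (c c' : int) : (p%:Z ^+ m %| c - c')%Z -> lat l m c = lat l m c'.
Proof.
have aux a b : (p%:Z ^+ m %| a - b)%Z -> lat l m a `<=` lat l m b.
  move=> ab x Lx; have /qorderP[u [v xE]] := lat_qorder Lx.
  move: Lx; rewrite {}xE => /lat_elt[h1 h2]; apply/lat_elt; split=> //.
  have -> : u - b * v = u - a * v + v * (a - b) by ring.
  by apply: dvdz_add => //; rewrite exprD; apply: dvdz_mul.
move=> cc; apply/seteqP; split; apply: aux => //.
by rewrite -opprB dvdzE abszN -dvdzE.
Qed.

Lemma lat_invertible l m c : (p%:Z ^+ m %| qform c 1)%Z -> (p%:Z %| t)%Z -> (p%:Z %| n)%Z ->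
  (invertible_ideal qorder (lat l m c) <-> m = 0%N \/ ~ (p%:Z ^+ m.+1 %| qform c 1)%Z).
Proof.
move=> pm pt pn; have idL := (lat_idealP l m c).2 pm.
have [LO _ _ LM] := idL.
have /dvdzP[G GE] := pm.
have pm0 k : p%:Z ^+ k != 0 by rewrite expf_neq0 ?prime_neq0z.
have pGE : (p%:Z ^+ m.+1 %| qform c 1)%Z = (p%:Z %| G)%Z.
  by rewrite GE exprS dvdz_mul2r.
split=> [[_ inv]|cop].
  case: m => [|m] in pm idL LO LM G GE pGE inv *; first by left.
  right; rewrite pGE => /dvdzP[H HE].
  have : ideal_mul (lat l m.+1 c) (ideal_inv qorder (lat l m.+1 c)) 1.
    by rewrite inv; apply: (qorder_int 1).
  move=> [k [a [b [La Lb e]]]].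
  have pc : (p%:Z %| c)%Z.
    have : (p%:Z %| c ^+ 2)%Z.
      have -> : c ^+ 2 = qform c 1 - c * t - n by rewrite /qform; ring.
      rewrite !dvdz_sub ?dvdz_mull // GE exprS mulrCA dvdz_mulr //.
    by rewrite prime_dvdzX // => /andP[].
  have /dvdzP[c' cE] := pc; have /dvdzP[t' tE] := pt.
  (* By p | t and p | c, multiplication by (c + th) / p preserves the lattice. *)
  have LS x : lat l m.+1 c x -> lat l m.+1 c ((c%:~R + th) / p%:R * x).
    move=> Lx; have /qorderP[u [v xE]] := LO _ Lx.
    move: Lx; rewrite {}xE => /lat_elt[/dvdzP[v' vE] /dvdzP[u' uE]].
    (* [U] and [V] are the coordinates of (c + th) x / p; [H] enters through N(c + th) = H
       p^(m+2). *)
    pose V := v' * p%:Z ^+ l * (2 * c' + t') + u' * p%:Z ^+ (l + m).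
    pose U := c * V - v' * H * p%:Z ^+ (l + m.+1).
    have : elt c 1 * elt u v = p%:R * elt U V.
      have {}uE : u = u' * p%:Z ^+ (l + m.+1) + c * v by rewrite -uE subrK.
      have nE : n = H * p%:Z * p%:Z ^+ m.+1 - c ^+ 2 - t * c.
        by rewrite -HE -GE /qform; ring.
      rewrite eltM -[p%:R]/(p%:Z%:~R) eltZ uE vE nE /U /V !exprD exprS.
      by congr elt; rewrite cE tE; ring.
    rewrite /(elt c 1) mul1r mulrAC => ->; rewrite mulrC mulKf ?(pK_neq0 1) //.
    apply/lat_elt; rewrite /U; split; last first.
      by rewrite addrAC subrr add0r -mulNr dvdz_mull.
    have -> : V = (v' * (2 * c' + t') + u' * p%:Z ^+ m) * p%:Z ^+ l.
      by rewrite /V exprD; ring.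
    exact: dvdz_mull.
  (* With 1 = sum of [a i * b i], each (c + th) / p times [a i] stays in the lattice, so its product
     with [b i] is in the order. But the coefficient of [th] in (c + th) / p is 1 / p. *)
  have : qorder ((c%:~R + th) / p%:R).
    have -> : (c%:~R + th) / p%:R = \sum_(i < k) (c%:~R + th) / p%:R * (a i * b i).
      by rewrite -mulr_sumr -e mulr1.
    apply: (big_ind qorder) => [||i _]; [exact: (qorder_int 0)|exact: qorderD|].
    by rewrite mulrA mulrC; exact: (Lb i _ (LS _ (La i))).
  move=> /qorderP[u [v uv]].
  have : elt c 1 = p%:Z%:~R * elt u v.
    by rewrite -uv mulrC divfK ?(pK_neq0 1) // /elt mul1r.
  rewrite eltZ => /elt_inj[_ e1].
  have : (p%:Z %| 1)%Z by apply/dvdzP; exists v; rewrite mulrC -e1.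
  by rewrite dvdz1 absz_nat => /eqP p1; have := p_prime; rewrite p1.
split=> //; apply/seteqP; split=> [|y Oy].
  apply: ideal_mul_sub; [exact: (qorder_int 0)|exact: qorderD|].
  by move=> x z Lx Iz; rewrite mulrC; apply: Iz.
(* Both alternatives make G = N(c + th) / p^m coprime to p^m: either p^m = 1, or p does not divide
   G. *)
have [u [w uw]] : exists u w : int, u * G + w * p%:Z ^+ m = 1.
  have : coprimez (p%:Z ^+ m) G.
    case: cop => [->|]; first by rewrite expr0 coprimezE coprime1n.
    by rewrite pGE => /negP; apply: prime_coprimezX.
  by move=> /eqP e; have [w [u h]] := Bezoutz (p%:Z ^+ m) G; exists u, w; rewrite addrC h e.
(* The relation u G + w p^m = 1 multiplied by y: the generator p^l (c + th) yields u G y through its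
   conjugate, the generator p^(l+m) yields w p^m y. It remains to see that the two cofactors lie in
   (O : I). *)
have -> : y = elt (p%:Z ^+ l * c) (p%:Z ^+ l) *
    (u%:~R * elt (c + t * 1) (-1) * y / p%:R ^+ (l + m)) +
   (p%:Z ^+ (l + m))%:~R * (w%:~R * y / p%:R ^+ l).
  have uwK : u%:~R * G%:~R + w%:~R * p%:R ^+ m = 1 :> K.
    by rewrite pK_int -!intrM -intrD uw.
  have GK : elt c 1 * elt (c + t * 1) (-1) = G%:~R * p%:R ^+ m.
    by rewrite elt_conjM GE intrM pK_int.
  have pl := pK_neq0 l; have pmn := pK_neq0 m.
  have -> : elt (p%:Z ^+ l * c) (p%:Z ^+ l) = p%:R ^+ l * elt c 1.
    by rewrite pK_int eltZ mulr1.
  rewrite -[LHS]mul1r -[in LHS]uwK -pK_int exprD.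
  have -> : p%:R ^+ l * elt c 1 * (u%:~R * elt (c + t * 1) (-1) * y / (p%:R ^+ l * p%:R ^+ m)) =
    (elt c 1 * elt (c + t * 1) (-1)) * u%:~R * y / p%:R ^+ m by field; rewrite pl pmn.
  by rewrite GK; field; rewrite pl pmn.
apply: mem_ideal_mul2; [exact: lat_gen| |exact: lat_p|].
  move=> x Lx; have /qorderP[a [b xE]] := LO _ Lx.
  move: Lx; rewrite {}xE => /lat_elt[/dvdzP[b' bE] /dvdzP[a' aE]].
  have -> : u%:~R * elt (c + t * 1) (-1) * y / p%:R ^+ (l + m) * elt a b =
      u%:~R * y * (elt (b' * G) 0 + a'%:~R * elt (c + t * 1) (-1)).
    have xE : elt (c + t * 1) (-1) * elt a b =
        p%:R ^+ (l + m) * (elt (b' * G) 0 + a'%:~R * elt (c + t * 1) (-1)).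
      have {}aE : a = a' * p%:Z ^+ (l + m) + c * b by rewrite -aE subrK.
      have nE : n = G * p%:Z ^+ m - c ^+ 2 - t * c by rewrite -GE /qform; ring.
      rewrite pK_int eltZ eltD eltM eltZ aE bE nE exprD.
      by congr elt; ring.
    have -> : u%:~R * elt (c + t * 1) (-1) * y / p%:R ^+ (l + m) * elt a b =
        u%:~R * y * (elt (c + t * 1) (-1) * elt a b) / p%:R ^+ (l + m) by ring.
    rewrite xE.
    by field; apply: pK_neq0.
  by apply: qorderM; [apply: qorderM => //; apply: qorder_int|rewrite eltZ eltD; apply: qorder_elt].
move=> x Lx; have /qorderP[a [b xE]] := LO _ Lx.
move: Lx; rewrite {}xE => /lat_elt[/dvdzP[b' bE] /dvdzP[a' aE]].
have {}aE : a = a' * p%:Z ^+ (l + m) + c * b by rewrite -aE subrK.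
have -> : w%:~R * y / p%:R ^+ l * elt a b = w%:~R * y * elt (a' * p%:Z ^+ m + c * b') b'.
  have -> : elt a b = p%:R ^+ l * elt (a' * p%:Z ^+ m + c * b') b'.
    by rewrite pK_int eltZ aE bE exprD; congr elt; ring.
  by field; apply: pK_neq0.
by apply: qorderM; [apply: qorderM => //; apply: qorder_int|apply: qorder_elt].
Qed.

(** * Primary ideals and ideal atoms above p *)

Section PrimaryIdeals.
Hypotheses (pt : (p%:Z %| t)%Z) (pn : (p%:Z ^+ 2 %| n)%Z).

Let p_dvd_n : (p%:Z %| n)%Z.
Proof. by apply: dvdz_trans pn; rewrite exprS dvdz_mulr. Qed.

Lemma dvdz_qform a b : (p%:Z %| qform a b)%Z = (p%:Z %| a)%Z.
Proof.
rewrite /qform -addrA dvdz_addl ?prime_dvdzX ?andbT //.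
apply: dvdz_add; last exact: dvdz_mulr.
by rewrite -mulrA dvdz_mulr.
Qed.

Lemma root0_elt u v : root_ideal 0 (elt u v) <-> (p%:Z %| u)%Z.
Proof. by rewrite root_idealE mulr0 subr0. Qed.

Lemma root0_prime : prime_ideal qorder (root_ideal 0).
Proof. by apply: root_ideal_prime; rewrite dvdz_qform dvdz0. Qed.

Lemma proper_sub_root0 (J : set K) k :
  is_ideal qorder J -> J <> qorder -> J (p%:Z ^+ k)%:~R -> J `<=` root_ideal 0.
Proof.
move=> idJ JO Jp x Jx; have [JsO _ _ _] := idJ.
have /qorderP[u [v xE]] := JsO _ Jx; rewrite xE; apply/root0_elt.
apply: contrapT => /negP; rewrite -(dvdz_qform u v) => h; apply: JO.
apply: ideal_coprime_eq Jp _ (prime_coprimezX k p_prime h) => //.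
by apply: ideal_norm => //; rewrite -xE.
Qed.

(* Since p | t and p^2 | n, the square of the maximal ideal lies in p times
   that ideal; a product of two proper ideals is too small to be an atom. *)
Lemma mul_proper_sub (J1 J2 : set K) k :
  is_ideal qorder J1 -> is_ideal qorder J2 -> J1 <> qorder -> J2 <> qorder ->
  ideal_mul J1 J2 (p%:Z ^+ k)%:~R ->
  ideal_mul J1 J2 `<=` [set x | exists u v, [/\ x = elt u v, (p%:Z ^+ 2 %| u)%Z & (p%:Z %| v)%Z]].
Proof.
move=> id1 id2 J1O J2O Jp.
have [S1 _ _ _] := id1; have [S2 _ _ _] := id2.
have Jp1 := ideal_mul_subl id1 id2 Jp; have Jp2 := ideal_mul_subr id1 id2 Jp.
apply: ideal_mul_sub => /= [|x y [u [v [-> h1 h2]]] [u' [v' [-> h3 h4]]]|x y Jx Jy].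
- by exists 0, 0; rewrite elt_int !dvdz0.
- by exists (u + u'), (v + v'); rewrite eltD; split=> //; apply: dvdz_add.
have /qorderP[u [v xE]] := S1 _ Jx; have /qorderP[u' [v' yE]] := S2 _ Jy.
move: (proper_sub_root0 id1 J1O Jp1 Jx) (proper_sub_root0 id2 J2O Jp2 Jy).
rewrite {}xE {}yE eltM => /root0_elt pu /root0_elt pu'.
exists (u * u' - n * v * v'), (u * v' + v * u' + t * v * v'); split=> //.
  by apply: dvdz_sub; [rewrite expr2 dvdz_mul|rewrite -mulrA dvdz_mulr].
apply: dvdz_add; first by apply: dvdz_add; [apply: dvdz_mulr|apply: dvdz_mull].
by rewrite -mulrA dvdz_mulr.
Qed.

Lemma principal_nat_lat : principal_nat qorder p = lat 1 0 0.
Proof.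
have lE u v : lat 1 0 0 (elt u v) <-> principal_nat qorder p (elt u v).
  by rewrite lat_elt principal_natP mul0r subr0 addn0 expr1; split=> -[].
apply/seteqP; split=> x.
  move=> Ix; have : qorder x by case: Ix => y Oy <-; apply: qorderM; first exact: qorder_nat.
  by case/qorderP=> u [v e]; rewrite e in Ix *; apply/lE.
by move=> Ix; have /qorderP[u [v e]] := lat_qorder Ix; rewrite e in Ix *; apply/lE.
Qed.

(** This factorization shows that a lattice with a factor p is not an atom, unless the cofactor is
    the whole order. *)
Lemma mul_p_lat l m c : is_ideal qorder (lat l m c) ->
  lat l.+1 m c = ideal_mul (principal_nat qorder p) (lat l m c).
Proof.
move=> idL; have [LO L0 LD LM] := idL.
have lE x : lat l.+1 m c x <-> exists2 y, lat l m c y & x = p%:R * y.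
  split=> [[a _ [b _ <-]]|[_ [a _ [b _ <-]] ->]].
    by eexists; [exists a => //; exists b => //|rewrite exprS mulrA].
  by exists a => //; exists b => //; rewrite exprS mulrA.
apply/seteqP; split=> [x /lE[y Ly ->]|].
  rewrite -[p%:R * y]addr0 -(mulr0 p%:R).
  by apply: mem_ideal_mul2 => //; apply: principal_nat_p.
apply: ideal_mul_sub => [|x y /lE[x' Lx ->] /lE[y' Ly ->]|_ y [x Ox <-] Ly].
- by apply/lE; exists 0; rewrite ?mulr0.
- by apply/lE; exists (x' + y'); [exact: LD|rewrite mulrDr].
- by apply/lE; exists (x * y); [exact: LM|rewrite mulrA].
Qed.

Lemma lat_atomP l m c : (1 <= l + m)%N -> (p%:Z ^+ m %| qform c 1)%Z ->
  ideal_atom qorder (lat l m c) <-> l = 0%N \/ (l = 1%N /\ m = 0%N).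
Proof.
move=> lm pm; have idL k : is_ideal qorder (lat k m c) by apply/lat_idealP.
split=> [|h].
  case: l lm => [|l] lm; first by left.
  case: (posnP (l + m)) => [/eqP|lm' [_ _ _ /(_ (lat 1 0 0) (lat l m c))]].
    by rewrite addn_eq0 => /andP[/eqP-> /eqP->]; right.
  have id1 : is_ideal qorder (lat 1 0 0) by apply/lat_idealP; rewrite dvd1z.
  move=> /(_ id1 (idL l)); rewrite -principal_nat_lat -mul_p_lat // principal_nat_lat.
  by case=> // /lat_proper; case.
split=> //; [exact: lat_neq0|exact: lat_proper|].
move=> J1 J2 id1 id2 e; apply: contrapT => /not_orP[J1O J2O].
have := lat_p l m c; have := lat_gen l m c; rewrite e => Lg Lp.
have sub := mul_proper_sub id1 id2 J1O J2O Lp.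
case: h => [l0|[l1 m0]].
  rewrite l0 expr0 in Lg; have [u [v [/elt_inj[_ <-] _]]] := sub _ Lg.
  by rewrite dvdz1 absz_nat => /eqP p1; have := p_prime; rewrite p1.
rewrite l1 m0 -elt_int in Lp; have [u [v [/elt_inj[<- _]]]] := sub _ Lp.
by rewrite dvdz_Pexp2l // ltz_nat prime_gt1.
Qed.

Lemma lat_radical l m c : (1 <= l + m)%N -> (p%:Z ^+ m %| qform c 1)%Z ->
  ideal_radical qorder (lat l m c) = root_ideal 0.
Proof.
move=> lm /(lat_idealP l) idL; have [LO _ _ LM] := idL.
have [[PO _ _ PM] _ Pp] := root0_prime.
apply/seteqP; split=> x.
  move=> [Ox [k _]] /(proper_sub_root0 idL (@lat_proper l m c lm) (lat_p _ _ _)).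
  elim: k => [|k IHk].
    rewrite expr0 -[1]/(1%:~R) -elt_int => /root0_elt.
    by rewrite dvdz1 absz_nat => /eqP p1; have := p_prime; rewrite p1.
  have OX : qorder (x ^+ k).
    by elim: k {IHk} => [|k IHk]; [exact: (qorder_int 1)|rewrite exprS; apply: qorderM].
  by rewrite exprS => /Pp[].
move=> Px; split; first exact: PO.
have /qorderP[u [v xE]] := PO _ Px.
move: Px; rewrite {}xE => /root0_elt /dvdzP[u' uE].
(* As p divides [t], [n] and [u], the square of u + v th is p times an element of the order; hence
   its (l + m)-th power is a multiple of p^(l+m), which is in the lattice. *)
exists (2 * (l + m))%N; first by rewrite muln_gt0.
have /dvdzP[t' tE] := pt; have /dvdzP[n' nE] := p_dvd_n.
have -> : elt u v ^+ (2 * (l + m)) =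
    elt (u' * u - n' * v * v) (u' * v + v * u' + t' * v * v) ^+ (l + m) * (p%:Z ^+ (l + m))%:~R.
  rewrite exprM rmorphXn -exprMn; congr (_ ^+ _).
  rewrite expr2 eltM [RHS]mulrC eltZ nE tE.
  by congr elt; rewrite uE; ring.
apply: LM; last exact: lat_p.
elim: (l + m)%N => [|k IHk]; first exact: (qorder_int 1).
by rewrite exprS; apply: qorderM => //; apply: qorder_elt.
Qed.

(** An ideal whose radical is maximal is primary: outside the radical, [b] has norm prime to p, so
    it is invertible modulo p^(l+m), and [a] is recovered from [a * b] by means of the conjugate of
    [b]. *)
Lemma lat_primary l m c : (1 <= l + m)%N -> (p%:Z ^+ m %| qform c 1)%Z ->
  primary_ideal qorder (lat l m c).
Proof.
move=> lm pm; split; [exact/lat_idealP|exact: lat_proper|].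
move=> a b Oa /qorderP[u [v bE]] Lab.
rewrite lat_radical //; have [|pu] := pselect (p%:Z %| u)%Z.
  by move=> pu; right; rewrite bE; apply/root0_elt.
left; have idL : is_ideal qorder (lat l m c) by apply/lat_idealP.
have [_ _ LD LM] := idL.
have /eqP cop : coprimez (p%:Z ^+ (l + m)) (qform u v).
  by apply: prime_coprimezX => //; rewrite dvdz_qform; apply/negP.
have [x [y xy]] := Bezoutz (p%:Z ^+ (l + m)) (qform u v).
have -> : a = x%:~R * a * (p%:Z ^+ (l + m))%:~R + y%:~R * elt (u + t * v) (- v) * (a * b).
  rewrite bE.
  have -> : x%:~R * a * (p%:Z ^+ (l + m))%:~R + y%:~R * elt (u + t * v) (- v) * (a * elt u v) =
    (x%:~R * (p%:Z ^+ (l + m))%:~R + y%:~R * (elt u v * elt (u + t * v) (- v))) * a by ring.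
  by rewrite elt_conjM -!intrM -intrD xy cop mul1r.
apply: LD.
  by apply: LM; [apply: qorderM => //; apply: qorder_int|exact: lat_p].
by apply: LM => //; apply: qorderM; [exact: qorder_int|exact: qorder_elt].
Qed.

(** Because q contains a power of p, every gcd met in the reduction is again a power of p. So are
    the diagonal entries: p^k0, the least power of p in q, and p^l, the least power of p that is a
    [th]-coefficient of an element of q. Then m = k0 - l. *)
Lemma ideal_is_lat (q : set K) k : is_ideal qorder q -> q <> qorder -> q (p%:Z ^+ k)%:~R ->
  exists l m c, [/\ (1 <= l + m)%N, (p%:Z ^+ m %| qform c 1)%Z & q = lat l m c].
Proof.
move=> idq qO qp; have [qsO q0 qD qM] := idq.
have exk : exists j, `[< q (p%:Z ^+ j)%:~R >] by exists k; apply/asboolP.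
case: (ex_minnP exk) => k0 /asboolP qk0 k0min {k exk qp}.
have qth : q (elt 0 (p%:Z ^+ k0)).
  have -> : elt 0 (p%:Z ^+ k0) = elt 0 1 * (p%:Z ^+ k0)%:~R by rewrite /elt; ring.
  by apply: qM => //; apply: qorder_elt.
have exl : exists j, `[< exists c, q (elt c (p%:Z ^+ j)) >].
  by exists k0; apply/asboolP; exists 0.
case: (ex_minnP exl) => l /asboolP[c0 qc0] lmin {exl}.
have int_q a : q a%:~R -> (p%:Z ^+ k0 %| a)%Z.
  move=> qa; have [j jk e] := gcdz_primeX k0 a p_prime.
  have [x [y xy]] := Bezoutz a (p%:Z ^+ k0).
  have qj : q (p%:Z ^+ j)%:~R.
    by rewrite -e -xy intrD !intrM; apply: qD; apply: ideal_intM.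
  have -> : k0 = j by apply/eqP; rewrite eqn_leq jk k0min //; apply/asboolP.
  by rewrite -e dvdz_gcdl.
have elt_q u v : q (elt u v) -> (p%:Z ^+ l %| v)%Z.
  move=> quv; have [j jl e] := gcdz_primeX l v p_prime.
  have [x [y xy]] := Bezoutz v (p%:Z ^+ l).
  have qj : q (elt (x * u + y * c0) (p%:Z ^+ j)).
    by rewrite -e -xy -eltD -!eltZ; apply: qD; apply: ideal_intM.
  have -> : l = j by apply/eqP; rewrite eqn_leq jl lmin //; apply/asboolP; exists (x * u + y * c0).
  by rewrite -e dvdz_gcdl.
have lk : (l <= k0)%N.
  by apply: lmin; apply/asboolP; exists 0.
(* Multiplying c0 + p^l th by [th] gives an element of q with [th]-coefficient c0 + t p^l, which p^l
   must divide. *)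
have /dvdzP[c c0E] : (p%:Z ^+ l %| c0)%Z.
  have := qM _ _ (qorder_elt 0 1) qc0; rewrite eltM => /elt_q.
  have -> : 0 * p%:Z ^+ l + 1 * c0 + t * 1 * p%:Z ^+ l = c0 + t * p%:Z ^+ l by ring.
  by rewrite dvdz_addl // dvdz_mull.
have qE : q = lat l (k0 - l) c.
  apply/seteqP; split=> x qx.
    have /qorderP[u [v xE]] := qsO _ qx; rewrite {}xE in qx *.
    have /dvdzP[w vE] := elt_q _ _ qx.
    apply/lat_elt; rewrite subnKC //; split; first by rewrite vE dvdz_mull.
    apply: int_q; rewrite -elt_int.
    have -> : elt (u - c * v) 0 = elt u v - w%:~R * elt c0 (p%:Z ^+ l).
      by rewrite eltZ eltB; congr elt; rewrite vE ?c0E; ring.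
    by apply: idealB => //; apply: ideal_intM.
  have /qorderP[u [v xE]] := lat_qorder qx; rewrite {}xE in qx *.
  have /lat_elt[/dvdzP[w vE] /dvdzP[y]] := qx; rewrite subnKC // => uE.
  have -> : elt u v = y%:~R * (p%:Z ^+ k0)%:~R + w%:~R * elt c0 (p%:Z ^+ l).
    by rewrite -(elt_int (p%:Z ^+ k0)) !eltZ eltD -uE; congr elt; rewrite vE ?c0E; ring.
  by apply: qD; apply: ideal_intM.
exists l, (k0 - l)%N, c; split=> //; last by apply/(lat_idealP l); rewrite -qE.
rewrite subnKC // lt0n; apply/eqP => k00; apply: qO.
by apply: ideal_eq_unit => //; rewrite k00 in qk0.
Qed.

End PrimaryIdeals.
(** * Decomposition of primes *)

Section PrimeDecomposition.

(** If p did not divide v, the product of u and an inverse [w] of v modulo p would be a root. The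
    identity for [qform (w * u) 1] comes from homogenizing with 1 = x p + w v. *)
Lemma noroot_norm u v : (forall a, ~ (p%:Z %| qform a 1)%Z) ->
  (p%:Z %| qform u v)%Z -> (p%:Z %| u)%Z /\ (p%:Z %| v)%Z.
Proof.
move=> noroot puv.
have pv : (p%:Z %| v)%Z.
  apply: contrapT => /negP; rewrite -prime_coprimez // => /eqP cop.
  have [x [w xw]] := Bezoutz p%:Z v; rewrite cop in xw.
  apply: (noroot (w * u)).
  have -> : qform (w * u) 1 = w ^+ 2 * qform u v +
      p%:Z * (t * w * u * x + n * x * (1 + w * v)).
    have -> : qform (w * u) 1 = (w * u) ^+ 2 + t * (w * u) * (x * p%:Z + w * v) +
      n * (x * p%:Z + w * v) ^+ 2 by rewrite xw /qform; ring.
    have -> : 1 + w * v = (x * p%:Z + w * v) + w * v by rewrite xw.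
    by rewrite /qform; ring.
  by apply: dvdz_add; [apply: dvdz_mull|apply: dvdz_mulr].
split=> //; move: puv; rewrite /qform -addrA dvdz_addl ?prime_dvdzX ?andbT //.
by apply: dvdz_add; [apply: dvdz_mull|rewrite expr2 mulrA dvdz_mull].
Qed.

Lemma noroot_sub (J : set K) : (forall a, ~ (p%:Z %| qform a 1)%Z) ->
  is_ideal qorder J -> J <> qorder -> J p%:R -> J `<=` principal_nat qorder p.
Proof.
move=> noroot idJ JO Jp x Jx; have [JsO _ _ _] := idJ.
have /qorderP[u [v xE]] := JsO _ Jx; rewrite xE; apply/principal_natP.
apply: noroot_norm => //; apply: contrapT => /negP; rewrite -prime_coprimez // => cop.
by apply: JO; apply: (ideal_coprime_eq (x := p%:Z)) cop => //; apply: ideal_norm; rewrite -?xE.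
Qed.

(** At a root, p divides the product of a + th and its conjugate but neither factor, their
    [th]-coefficients being 1 and -1. *)
Lemma inert_noroot a :
  prime_ideal qorder (principal_nat qorder p) -> ~ (p%:Z %| qform a 1)%Z.
Proof.
move=> [_ _ pP] pa.
have : principal_nat qorder p (elt a 1 * elt (a + t * 1) (- 1)).
  by rewrite elt_conjM -elt_int; apply/principal_natP; rewrite dvdz0.
by case/(pP _ _ (qorder_elt _ _) (qorder_elt _ _)) => /principal_natP[_];
  rewrite dvdzE ?abszN absz1 dvdn1 absz_nat => /eqP p1; have := p_prime; rewrite p1.
Qed.

(** Without a root, every proper ideal containing p lies in (p); then the product of P and Q lies in
    (p^2), which does not contain p. *)
Lemma prime_factors_root (P Q : set K) :
  prime_ideal qorder P -> prime_ideal qorder Q ->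
  principal_nat qorder p = ideal_mul P Q -> exists a, (p%:Z %| qform a 1)%Z.
Proof.
move=> [idP PO _] [idQ QO _] e; apply: contrapT => /forallNP noroot.
have pPQ : ideal_mul P Q p%:R by rewrite -e; apply: principal_nat_p.
have Pp := noroot_sub noroot idP PO (ideal_mul_subl idP idQ pPQ).
have Qp := noroot_sub noroot idQ QO (ideal_mul_subr idP idQ pPQ).
have sub : ideal_mul P Q `<=` [set x | exists2 y, qorder y & x = (p%:Z ^+ 2)%:~R * y].
  apply: ideal_mul_sub => [|_ _ [x Ox ->] [y Oy ->]|_ _ /Pp[x Ox <-] /Qp[y Oy <-]] /=.
  - by exists 0; rewrite ?mulr0 //; apply: (qorder_int 0).
  - by exists (x + y); rewrite ?mulrDr //; apply: qorderD.
  - by exists (x * y); [exact: qorderM|rewrite -pK_int; ring].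
have [y /qorderP[u [v ->]]] := sub _ pPQ.
rewrite eltZ -[p%:R]/(p%:Z%:~R) -elt_int => /elt_inj[pE _].
have : (p%:Z ^+ 2 %| p%:Z ^+ 1)%Z by apply/dvdzP; exists u; rewrite mulrC expr1.
by rewrite dvdz_Pexp2l // ltz_nat prime_gt1.
Qed.

(** Since p divides the norm of a + th, P contains c + th for one of the two roots c = a, - t - a.
    Its square lies in P^2 = (p), and the [th]-coefficient of that square is 2 c + t, equal to 2 a +
    t up to sign. *)
Lemma ramified_root (P : set K) :
  prime_ideal qorder P -> principal_nat qorder p = ideal_mul P P ->
  exists a, (p%:Z %| qform a 1)%Z /\ (p%:Z %| 2 * a + t)%Z.
Proof.
move=> Ppr e; have [a pa] := prime_factors_root Ppr Ppr e.
have [idP PO PP] := Ppr; exists a; split=> //.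
have pc c : P (elt c 1) -> (p%:Z %| 2 * c + t)%Z.
  move=> Pc; have : ideal_mul P P (elt c 1 * elt c 1 + elt c 1 * 0).
    by apply: mem_ideal_mul2 => //; case: idP.
  rewrite mulr0 addr0 -e eltM => /principal_natP[_].
  by rewrite (_ : c * 1 + _ + _ = 2 * c + t) //; ring.
have : P (elt a 1 * elt (- t - a) 1).
  apply: (ideal_mul_subl idP idP); rewrite -e.
  have -> : elt a 1 * elt (- t - a) 1 = elt (- qform a 1) 0.
    by rewrite eltM /qform; congr elt; ring.
  by apply/principal_natP; rewrite dvdz0 dvdzE abszN -dvdzE.
case/(PP _ _ (qorder_elt _ _) (qorder_elt _ _)) => /pc //.
by rewrite (_ : 2 * _ + t = - (2 * a + t)) ?dvdzE ?abszN -?dvdzE //; ring.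
Qed.

Lemma prime_above_eq (P : set K) a : prime_ideal qorder P -> P p%:R -> P (elt a 1) ->
  P = root_ideal a.
Proof.
move=> [idP PO _] Pp Pa; have [PsO _ PD _] := idP.
apply/seteqP; split=> x Px.
  have /qorderP[u [v xE]] := PsO _ Px; rewrite {}xE in Px *; apply/root_idealE.
  apply: contrapT => /negP; rewrite -prime_coprimez // => cop.
  apply: PO; apply: (ideal_coprime_eq (x := p%:Z)) cop => //.
  have -> : (u - v * a)%:~R = elt u v - v%:~R * elt a 1 by rewrite /elt; ring.
  by apply: idealB => //; apply: ideal_intM.
have [u [v [-> /dvdzP[k uE]]]] := Px.
have -> : elt u v = k%:~R * p%:R + v%:~R * elt a 1.
  rewrite -[p%:R]/(p%:Z%:~R) -intrM -uE eltZ -elt_int eltD.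
  by congr elt; ring.
by apply: PD; apply: ideal_intM.
Qed.

(** If the root were double, (a + th)^2 would lie in (p), so P and Q would both contain a + th and
    both be [root_ideal a]. Conversely, two distinct roots give two distinct kernels, whose product
    is (p). *)
Lemma split_rootP :
  (exists P Q : set K, [/\ prime_ideal qorder P, prime_ideal qorder Q, P <> Q
     & principal_nat qorder p = ideal_mul P Q]) <->
  exists a, (p%:Z %| qform a 1)%Z /\ ~ (p%:Z %| 2 * a + t)%Z.
Proof.
split=> [[P [Q [Ppr Qpr PQ e]]]|[a [pa npa]]].
  have [a pa] := prime_factors_root Ppr Qpr e; exists a; split=> // pa2.
  have [idP PO PP] := Ppr; have [idQ QO QQ] := Qpr.
  have a2 : ideal_mul P Q (elt a 1 * elt a 1).
    rewrite -e eltM; apply/principal_natP.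
    rewrite (_ : _ - _ = a * (2 * a + t) - qform a 1); last by rewrite /qform; ring.
    rewrite (_ : a * 1 + _ + _ = 2 * a + t); last ring.
    by split=> //; apply: dvdz_sub => //; apply: dvdz_mull.
  have p1 : ideal_mul P Q p%:R by rewrite -e; apply: principal_nat_p.
  have Pa : P (elt a 1).
    by have /(PP _ _ (qorder_elt _ _) (qorder_elt _ _))[] := ideal_mul_subl idP idQ a2.
  have Qa : Q (elt a 1).
    by have /(QQ _ _ (qorder_elt _ _) (qorder_elt _ _))[] := ideal_mul_subr idP idQ a2.
  apply: PQ; transitivity (root_ideal a).
    by apply: prime_above_eq => //; apply: (ideal_mul_subl idP idQ p1).
  by apply/esym; apply: prime_above_eq => //; apply: (ideal_mul_subr idP idQ p1).
pose b := - t - a.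
have pb : (p%:Z %| qform b 1)%Z by rewrite (_ : qform b 1 = qform a 1) // /b /qform; ring.
exists (root_ideal a), (root_ideal b); split; try exact: root_ideal_prime.
  move=> ab; apply: npa; have : root_ideal a (elt a 1).
    by apply/root_idealE; rewrite mul1r subrr dvdz0.
  by rewrite ab => /root_idealE; rewrite /b (_ : a - _ = 2 * a + t) //; ring.
apply/seteqP; split=> [_ [y Oy <-]|].
  have /eqP cop : coprimez p%:Z (2 * a + t) by rewrite prime_coprimez //; apply/negP.
  have [x [w xw]] := Bezoutz p%:Z (2 * a + t); rewrite cop in xw.
  (* The difference of a + th and b + th is 2 a + t, which is prime to p; Bezout then expresses p
     through p^2, p (a + th) and p (b + th). *)
  have -> : p%:R * y = p%:R * (x%:~R * y * p%:R - w%:~R * y * elt b 1) +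
      elt a 1 * (w%:~R * y * p%:R).
    have -> : p%:R * (x%:~R * y * p%:R - w%:~R * y * elt b 1) + elt a 1 * (w%:~R * y * p%:R) =
       p%:R * y * (x%:~R * p%:Z%:~R + w%:~R * (elt a 1 - elt b 1)) by ring.
    rewrite eltB subrr elt_int (_ : a - b = 2 * a + t); last by rewrite /b; ring.
    by rewrite -!intrM -intrD xw mulr1.
  have [[_ _ _ MQ] _ _] := root_ideal_prime pb; have [idb _ _] := root_ideal_prime pb.
  have Oi k : qorder (k%:~R * y) by apply: qorderM => //; apply: qorder_int.
  apply: mem_ideal_mul2; [exact: root_ideal_p| | |].
  - apply: idealB => //; apply: MQ => //; first exact: root_ideal_p.
    by apply/root_idealE; rewrite mul1r subrr dvdz0.
  - by apply/root_idealE; rewrite mul1r subrr dvdz0.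
  - by apply: MQ => //; apply: root_ideal_p.
have [[_ J0 JD _] _ _] := root_ideal_prime pa.
apply: ideal_mul_sub => [|x y [x' Ox <-] [y' Oy <-]|x y [u [v [-> h1]]] [u' [v' [-> h2]]]].
- by exists 0; rewrite ?mulr0 //; apply: (qorder_int 0).
- by exists (x' + y'); rewrite ?mulrDr //; apply: qorderD.
rewrite eltM; apply/principal_natP.
have -> : u * u' - n * v * v' = (u - v * a) * u' + v * a * (u' - v' * b) - v * v' * qform a 1.
  by rewrite /b /qform; ring.
have -> : u * v' + v * u' + t * v * v' = (u - v * a) * v' + v * (u' - v' * b).
  by rewrite /b; ring.
split; last by apply: dvdz_add; [apply: dvdz_mulr|apply: dvdz_mull].
apply: dvdz_sub; last exact: dvdz_mull.
by apply: dvdz_add; [apply: dvdz_mulr|apply: dvdz_mull].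
Qed.

End PrimeDecomposition.
End Prime.
End QuadraticOrder.

(** * Counting residues with given valuation of the norm *)

Section Counting.
Variable (p : nat).
Hypothesis p_prime : prime p.

Let pX_neq0 k : p%:Z ^+ k != 0.
Proof. by rewrite expf_neq0 ?prime_neq0z. Qed.

Definition residues (m k : nat) (a : int) : {set 'I_(p ^ m)} :=
  finset (fun r : 'I_(p ^ m) => (p%:Z ^+ k %| r%:Z - a)%Z).

Lemma card_residues m k j a : m = (k + j)%N -> #|residues m k a| = (p ^ j)%N.
Proof.
move=> mkj; set w := (p ^ j)%N; set q := (p ^ k)%N.
have q0 : (0 < q)%N by rewrite expn_gt0 prime_gt0.
have mE : (p ^ m = w * q)%N by rewrite -expnD addnC -mkj.
have qE : p%:Z ^+ k = q%:Z by rewrite -rmorphXn.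
have [b bq ab] := int_mod_nat a q0.
have lt (i : 'I_w) : (i * q + b < p ^ m)%N by rewrite mE; have := ltn_ord i; nia.
rewrite -[RHS]card_ord -(card_imset predT (f := fun i => Ordinal (lt i))); last first.
  move=> i1 i2 /(congr1 val) /= /addIn /eqP; rewrite eqn_pmul2r // => /eqP.
  exact: val_inj.
apply: eq_card => r; rewrite inE qE.
have rb : (q%:Z %| r%:Z - a)%Z = (q%:Z %| r%:Z - b%:Z)%Z.
  by rewrite -(dvdz_addl _ ab) (_ : r%:Z - a + (a - b%:Z) = r%:Z - b%:Z) //; ring.
rewrite rb; apply/idP/imsetP => [h|[i _ ->] /=]; last first.
  by rewrite PoszD addrK PoszM dvdz_mull.
have rE : (r %% q = b)%N.
  apply: (@small_dvdz_eq q) => //; first exact: ltn_pmod.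
  rewrite (_ : _ - _ = r%:Z - b%:Z - (r %/ q)%N%:Z * q%:Z).
    by apply: dvdz_sub => //; apply: dvdz_mull.
  by rewrite {2}(divn_eq r q) PoszD PoszM; ring.
have iw : (r %/ q < w)%N by rewrite ltn_divLR // -mE.
by exists (Ordinal iw) => //; apply: val_inj; rewrite /= -rE -divn_eq.
Qed.

Lemma residuesS m k a : residues m k.+1 a \subset residues m k a.
Proof.
by apply/fintype.subsetP => r; rewrite !inE; apply: dvdz_trans; rewrite exprS dvdz_mull.
Qed.

Lemma card_residuesD m k j a : (0 < j)%N -> m = (k + j)%N ->
  #|residues m k a :\: residues m k.+1 a| = (p ^ j - p ^ j.-1)%N.
Proof.
move=> j0 mkj; rewrite cardsD (finset.setIidPr (residuesS _ _ _)).
by rewrite (card_residues _ mkj) (@card_residues m k.+1 j.-1) // addSnnS prednK.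
Qed.

Lemma totient_primeX k : (0 < k)%N -> totient (p ^ k) = (p ^ k - p ^ k.-1)%N.
Proof.
by case: k => // k _; rewrite totient_pfactor // expnS -subn1 mulnBl mul1n.
Qed.

Lemma residues_disjoint m k (a b : int) :
  ~~ (p%:Z ^+ k %| a - b)%Z -> residues m k a :&: residues m k b = finset.set0.
Proof.
move=> nab; apply/finset.setP => r; rewrite !inE.
apply/negP => /andP[ra rb]; move/negP: nab; apply.
by rewrite (_ : a - b = (r%:Z - b) - (r%:Z - a)); [exact: dvdz_sub|ring].
Qed.

Section Forms.
Variables (t0 n0 : int) (f v f' : nat).
Hypotheses (fE : f%:Z = p%:Z ^+ v * f'%:Z) (p_f' : ~~ (p%:Z %| f'%:Z)%Z).

(** The norm of c + f omega, when omega has trace [t0] and norm [n0]; the conductor stays visible so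
    that powers of p can be extracted. *)
Definition oform (c : int) := qform (f%:Z * t0) (f%:Z ^+ 2 * n0) c 1.

Definition exact_dvd (m : nat) (c : int) :=
  (p%:Z ^+ m %| oform c)%Z && ~~ (p%:Z ^+ m.+1 %| oform c)%Z.

Definition exact_residues (m : nat) (r0 : int) : {set 'I_(p ^ m)} :=
  finset (fun r : 'I_(p ^ m) => exact_dvd m (r%:Z - r0)).

Lemma oform_dvd_even j c : (j <= v)%N -> (p%:Z ^+ j %| c)%Z -> (p%:Z ^+ (2 * j) %| oform c)%Z.
Proof.
move=> jv /dvdzP[u cE]; apply/dvdzP.
exists (u ^+ 2 + p%:Z ^+ (v - j) * f'%:Z * t0 * u + (p%:Z ^+ (v - j)) ^+ 2 * f'%:Z ^+ 2 * n0).
have fE' : f%:Z = p%:Z ^+ j * p%:Z ^+ (v - j) * f'%:Z by rewrite -exprD subnKC.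
by rewrite /oform /qform fE' cE mulnC exprM; ring.
Qed.

(** Induction, one factor at a time: if c = p^i u with i < v, then p^(i+1) divides f, and the norm
    is p^(2i) times a number congruent to u^2 modulo p. *)
Lemma oform_dvd_odd j c : (j < v)%N -> (p%:Z ^+ (2 * j).+1 %| oform c)%Z -> (p%:Z ^+ j.+1 %| c)%Z.
Proof.
move=> jv; have step i : (i < v)%N -> (p%:Z ^+ i %| c)%Z ->
    (p%:Z ^+ (2 * i).+1 %| oform c)%Z -> (p%:Z ^+ i.+1 %| c)%Z.
  move=> iv /dvdzP[u cE].
  have fE' : f%:Z = p%:Z ^+ i * (p%:Z * p%:Z ^+ (v - i.+1)) * f'%:Z.
    by rewrite -exprS -subSn // subSS -exprD subnKC // ltnW.
  have -> : oform c = p%:Z ^+ (2 * i) * (u ^+ 2 + p%:Z * (p%:Z ^+ (v - i.+1) * f'%:Z * t0 * u +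
      p%:Z * (p%:Z ^+ (v - i.+1)) ^+ 2 * f'%:Z ^+ 2 * n0)).
    by rewrite /oform /qform fE' cE mulnC exprM; ring.
  rewrite [_ ^+ (2 * i).+1]exprSr dvdz_mul2l // dvdz_addl; last exact: dvdz_mulr.
  rewrite prime_dvdzX // andbT => pu.
  by rewrite cE exprS dvdz_mul.
elim: j jv => [|j IHj] jv h; first by apply: step.
apply: step => //; apply: IHj; first exact: ltnW.
by apply: dvdz_trans h; apply: dvdz_exp2l; lia.
Qed.

Lemma exact_dvd_even h c : (h < v)%N ->
  exact_dvd (2 * h) c = (p%:Z ^+ h %| c)%Z && ~~ (p%:Z ^+ h.+1 %| c)%Z.
Proof.
move=> hv; rewrite /exact_dvd; congr (_ && ~~ _); apply/idP/idP.
- case: h hv => [|h] hv; first by rewrite expr0 dvd1z.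
  move=> g; apply: oform_dvd_odd; first exact: ltnW.
  by apply: dvdz_trans g; apply: dvdz_exp2l; lia.
- by apply: oform_dvd_even; apply: ltnW.
- exact: oform_dvd_odd.
- move=> /(oform_dvd_even hv); apply: dvdz_trans; apply: dvdz_exp2l; lia.
Qed.

(** Below 2 v the valuation of the norm is even: p^(2h+1) forces p^(h+1) to divide c, and this
    already gives p^(2h+2). *)
Lemma exact_dvd_odd h c : (h < v)%N -> ~~ exact_dvd (2 * h).+1 c.
Proof.
move=> hv; apply/negP => /andP[/(oform_dvd_odd hv) /(oform_dvd_even hv)].
by rewrite mulnS => ->.
Qed.

Hypothesis v_gt0 : (0 < v)%N.

Lemma dvd_oform_double c : (p%:Z ^+ (2 * v) %| oform c)%Z = (p%:Z ^+ v %| c)%Z.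
Proof.
apply/idP/idP; last exact: oform_dvd_even.
move=> h; rewrite -(ltn_predK v_gt0); apply: oform_dvd_odd; first by lia.
by apply: dvdz_trans h; apply: dvdz_exp2l; lia.
Qed.

Lemma oform_dvdD j c : (p%:Z ^+ (2 * v + j) %| oform c)%Z ->
  exists u, c = p%:Z ^+ v * u.
Proof.
move=> h; have : (p%:Z ^+ (2 * v) %| oform c)%Z.
  by apply: dvdz_trans h; apply: dvdz_exp2l; lia.
by rewrite dvd_oform_double => /dvdzP[u ->]; exists u; rewrite mulrC.
Qed.

(** Past p^(2v) the conductor survives only as the unit [f'] modulo p, so that what matters is how
    close u / f' is to a root of X^2 + t0 X + n0. *)
Lemma dvd_oform_mul j u :
  (p%:Z ^+ (2 * v + j) %| oform (p%:Z ^+ v * u))%Z = (p%:Z ^+ j %| qform t0 n0 u f'%:Z)%Z.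
Proof.
have -> : oform (p%:Z ^+ v * u) = p%:Z ^+ (2 * v) * qform t0 n0 u f'%:Z.
  by rewrite /oform /qform fE mulnC exprM; ring.
by rewrite exprD dvdz_mul2l.
Qed.

Let in_residues m k a (r : 'I_(p ^ m)) b :
  (r \in residues m k (b + a)) = (p%:Z ^+ k %| r%:Z - b - a)%Z.
Proof. by rewrite inE opprD addrA. Qed.

Lemma card_exact_even r0 h : (0 < h)%N -> (h < v)%N ->
  #|exact_residues (2 * h) r0| = totient (p ^ h).
Proof.
move=> h0 hv; rewrite totient_primeX // -(@card_residuesD (2 * h) h h (r0 + 0)) //; last by lia.
apply: eq_card => r; rewrite finset.in_setD !in_residues !subr0 inE exact_dvd_even //.
exact: andbC.
Qed.

Lemma card_exact_odd r0 m : odd m -> (m < 2 * v)%N -> #|exact_residues m r0| = 0%N.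
Proof.
move=> om mv; apply: eq_card0 => r; rewrite inE; apply/negbTE; move: (_ - r0) => c.
have -> : m = (2 * m./2).+1 by rewrite -{1}(odd_double_half m) om mul2n.
by apply: exact_dvd_odd; rewrite -(odd_double_half m) om -mul2n in mv; lia.
Qed.

(** * Counting for an inert prime: no root modulo p *)

Section NoRoot.
Hypothesis noroot : forall a, ~ (p%:Z %| qform t0 n0 a 1)%Z.

Lemma noroot_oform j c : (0 < j)%N -> ~~ (p%:Z ^+ (2 * v + j) %| oform c)%Z.
Proof.
move=> j0; apply/negP => h; have [u cE] := oform_dvdD h.
move: h; rewrite cE dvd_oform_mul => h.
have {}h : (p%:Z %| qform t0 n0 u f'%:Z)%Z.
  by apply: dvdz_trans h; case: j j0 => // j _; rewrite exprS dvdz_mulr.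
by have [_] := noroot_norm p_prime noroot h; apply/negP.
Qed.

Lemma card_exact_noroot_double r0 : #|exact_residues (2 * v) r0| = (p ^ v)%N.
Proof.
rewrite -(@card_residues (2 * v) v v (r0 + 0)); last by lia.
apply: eq_card => r; rewrite in_residues subr0 inE /exact_dvd dvd_oform_double.
by rewrite -(addn1 (2 * v)) (noroot_oform (j := 1)) ?andbT.
Qed.

Lemma card_exact_noroot r0 m : (2 * v < m)%N -> #|exact_residues m r0| = 0%N.
Proof.
move=> vm; apply: eq_card0 => r; rewrite inE /exact_dvd; move: (_ - r0) => c.
have j0 : (0 < m - 2 * v)%N by rewrite subn_gt0 vm.
by have /negPf := noroot_oform c j0; rewrite subnKC ?(ltnW vm) // => ->.
Qed.

End NoRoot.

(** * Counting for a ramified prime: a double root modulo p *)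

Section DoubleRoot.
Variable (a : int).
Hypotheses (pa : (p%:Z %| qform t0 n0 a 1)%Z) (pa2 : (p%:Z %| 2 * a + t0)%Z).
Hypothesis npa : ~ (p%:Z ^+ 2 %| qform t0 n0 a 1)%Z.

Let A := p%:Z ^+ v * (f'%:Z * a).

(** Taylor expansion at the root f' a. The linear coefficient and the constant term are divisible by
    p, so that modulo p only the square remains. *)
Let qE u : qform t0 n0 u f'%:Z = (u - f'%:Z * a) ^+ 2 +
  f'%:Z * (2 * a + t0) * (u - f'%:Z * a) + f'%:Z ^+ 2 * qform t0 n0 a 1.
Proof. by rewrite /qform; ring. Qed.

Lemma double_root_oform1 c :
  (p%:Z ^+ (2 * v).+1 %| oform c)%Z = (p%:Z ^+ v.+1 %| c - A)%Z.
Proof.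
have key u : (p%:Z ^+ (2 * v).+1 %| oform (p%:Z ^+ v * u))%Z =
    (p%:Z ^+ v.+1 %| p%:Z ^+ v * u - A)%Z.
  rewrite -addn1 dvd_oform_mul expr1 /A -mulrBr exprSr dvdz_mul2l // qE.
  rewrite -addrA dvdz_addl ?prime_dvdzX ?andbT //.
  by apply: dvdz_add; [rewrite -mulrA mulrCA dvdz_mulr|apply: dvdz_mull].
apply/idP/idP => h.
  by move: (h); rewrite -addn1 => /oform_dvdD[u cE]; move: h; rewrite cE key.
have /dvdzP[u cE] : (p%:Z ^+ v %| c)%Z.
  rewrite (_ : c = c - A + A); last by ring.
  by apply: dvdz_add; [apply: dvdz_trans h; apply: dvdz_exp2l|apply: dvdz_mulr].
by move: h; rewrite cE mulrC key.
Qed.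

(** Once u = f' a modulo p, the first two terms of the expansion are divisible by p^2, while the
    constant term is not. *)
Lemma double_root_oform2 j c : (1 < j)%N -> ~~ (p%:Z ^+ (2 * v + j) %| oform c)%Z.
Proof.
move=> j1; apply/negP => h; have [u cE] := oform_dvdD h.
have h1 : (p%:Z ^+ (2 * v).+1 %| oform c)%Z by apply: dvdz_trans h; apply: dvdz_exp2l; lia.
move: h1; rewrite double_root_oform1 cE /A -mulrBr exprSr dvdz_mul2l // => pu.
move: h; rewrite cE dvd_oform_mul => h.
have {}h : (p%:Z ^+ 2 %| qform t0 n0 u f'%:Z)%Z.
  by apply: dvdz_trans h; apply: dvdz_exp2l.
apply: npa; move: h; rewrite qE addrC dvdz_addl; last first.
  apply: dvdz_add; first exact: dvdz_exp2r.
  by rewrite expr2 -mulrA dvdz_mull // dvdz_mul.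
by rewrite Gauss_dvdzr // coprimezXl // coprimezXr // prime_coprimez.
Qed.

(** Valuation exactly 2 v means that c is a multiple of p^v outside the class of [A] modulo p^(v+1);
    this leaves p^v - p^(v-1) residues. *)
Lemma card_exact_double_root_double r0 : #|exact_residues (2 * v) r0| = totient (p ^ v).
Proof.
rewrite totient_primeX // -(@card_residuesD (2 * v) v v (r0 + A)) //; last by lia.
apply: eq_card => r; rewrite finset.in_setD !in_residues inE /exact_dvd dvd_oform_double.
rewrite double_root_oform1 andbC; congr (_ && _).
by rewrite [RHS]dvdz_addl // dvdzE abszN -dvdzE dvdz_mulr.
Qed.

Lemma card_exact_double_rootS r0 : #|exact_residues (2 * v).+1 r0| = (p ^ v)%N.
Proof.
rewrite -(@card_residues (2 * v).+1 v.+1 v (r0 + A)); last by lia.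
apply: eq_card => r; rewrite in_residues inE /exact_dvd double_root_oform1.
by rewrite -(addn2 (2 * v)) (double_root_oform2 (j := 2)) ?andbT.
Qed.

Lemma card_exact_double_root r0 m : ((2 * v).+1 < m)%N -> #|exact_residues m r0| = 0%N.
Proof.
move=> vm; apply: eq_card0 => r; rewrite inE /exact_dvd; move: (_ - r0) => c.
have j1 : (1 < m - 2 * v)%N by rewrite ltn_subRL addn1.
by have /negPf := double_root_oform2 c j1; rewrite subnKC ?(ltnW (ltnW vm)) // => ->.
Qed.

End DoubleRoot.

(** * Counting for a split prime: two simple roots modulo p *)

Section SimpleRoot.
Variable (a : int).
Hypotheses (pa : (p%:Z %| qform t0 n0 a 1)%Z) (npa2 : ~ (p%:Z %| 2 * a + t0)%Z).

Lemma hensel k : exists x, (p%:Z ^+ k.+1 %| qform t0 n0 x f'%:Z)%Z /\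
  ~~ (p%:Z %| 2 * x + f'%:Z * t0)%Z.
Proof.
elim: k => [|k [x [px npx]]].
  exists (f'%:Z * a); split.
    rewrite (_ : qform _ _ _ _ = f'%:Z ^+ 2 * qform t0 n0 a 1); last by rewrite /qform; ring.
    by rewrite expr1 dvdz_mull.
  rewrite (_ : _ + _ = f'%:Z * (2 * a + t0)); last by ring.
  by rewrite prime_dvdzM // negb_or p_f'; apply/negP.
have /eqP cop : coprimez p%:Z (2 * x + f'%:Z * t0) by rewrite prime_coprimez.
have [w [y wy]] := Bezoutz p%:Z (2 * x + f'%:Z * t0); rewrite cop in wy.
(* Newton step: [y] inverts the derivative 2 x + f' t0 modulo p, and the new value is q (1 - y (2 x
   + f' t0)) + (y q)^2. *)
pose q := qform t0 n0 x f'%:Z; exists (x - y * q); split.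
  rewrite (_ : qform _ _ _ _ = q * (p%:Z * w) + (y * q) ^+ 2).
    apply: dvdz_add.
      by rewrite exprSr mulrA -[X in (X %| _)%Z]mulr1 dvdz_mul ?dvd1z // dvdz_mul.
    rewrite exprMn dvdz_mull //; apply: dvdz_trans (dvdz_exp2r 2 px).
    by rewrite -exprM dvdz_exp2l //; lia.
  have -> : p%:Z * w = 1 - y * (2 * x + f'%:Z * t0).
    transitivity (w * p%:Z + y * (2 * x + f'%:Z * t0) - y * (2 * x + f'%:Z * t0)); first by ring.
    by rewrite wy.
  by rewrite /q /qform; ring.
rewrite (_ : _ + _ = 2 * x + f'%:Z * t0 - 2 * y * q); last by ring.
rewrite dvdz_addl // dvdzE abszN -dvdzE dvdz_mull //.
by apply: dvdz_trans px; rewrite exprS dvdz_mulr.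
Qed.

(** Modulo p^(k+1) the form factors as (u - x) (u - y), where y is the conjugate root. As p does not
    divide x - y, only one factor can absorb powers of p. [A] and [B] stand for p^v times the two
    p-adic roots, known to the precision [k]. *)
Lemma simple_root_oform k : exists A B,
  [/\ (p%:Z ^+ v %| A)%Z, (p%:Z ^+ v %| B)%Z, ~~ (p%:Z ^+ v.+1 %| A - B)%Z &
    forall j c, (j <= k)%N -> (p%:Z ^+ (2 * v + j) %| oform c)%Z =
      (p%:Z ^+ (v + j) %| c - A)%Z || (p%:Z ^+ (v + j) %| c - B)%Z].
Proof.
have [x [px npx]] := hensel k; pose y := - (f'%:Z * t0) - x.
have xy : x - y = 2 * x + f'%:Z * t0 by rewrite /y; ring.
exists (p%:Z ^+ v * x), (p%:Z ^+ v * y); split; try exact: dvdz_mulr.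
  by rewrite -mulrBr exprSr dvdz_mul2l // xy.
move=> j c jk.
have key u : (p%:Z ^+ (2 * v + j) %| oform (p%:Z ^+ v * u))%Z =
    (p%:Z ^+ (v + j) %| p%:Z ^+ v * u - p%:Z ^+ v * x)%Z ||
    (p%:Z ^+ (v + j) %| p%:Z ^+ v * u - p%:Z ^+ v * y)%Z.
  rewrite dvd_oform_mul -!mulrBr exprD !dvdz_mul2l //.
  have -> : qform t0 n0 u f'%:Z = (u - x) * (u - y) + qform t0 n0 x f'%:Z.
    by rewrite /y /qform; ring.
  rewrite dvdz_addl; last by apply: dvdz_trans px; apply: dvdz_exp2l; lia.
  apply/idP/orP => [h|[h|h]]; [|exact: dvdz_mulr|exact: dvdz_mull].
  have [pu|npu] := boolP (p%:Z %| u - x)%Z.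
    left; move: h; rewrite Gauss_dvdzl // prime_coprimezX //.
    apply/negP => pu'; move/negP: npx; apply.
    by rewrite -xy (_ : x - y = (u - y) - (u - x)); [exact: dvdz_sub|ring].
  by right; move: h; rewrite Gauss_dvdzr // prime_coprimezX.
have dv z : (p%:Z ^+ (v + j) %| c - p%:Z ^+ v * z)%Z -> exists u, c = p%:Z ^+ v * u.
  move=> h; have /dvdzP[u ->] : (p%:Z ^+ v %| c)%Z; last by exists u; rewrite mulrC.
  rewrite (_ : c = c - p%:Z ^+ v * z + p%:Z ^+ v * z); last by ring.
  by apply: dvdz_add; [apply: dvdz_trans h; apply: dvdz_exp2l; lia|apply: dvdz_mulr].
apply/idP/idP => h.
  by have [u cE] := oform_dvdD h; move: h; rewrite cE key.
by have [u cE] : exists u, c = p%:Z ^+ v * u; [case/orP: h; apply: dv|move: h; rewrite cE key].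
Qed.

Lemma card_exact_simple_root_double r0 :
  #|exact_residues (2 * v) r0| = (p ^ v.-1 * (p - 2))%N.
Proof.
have [A [B [pA pB AB E]]] := simple_root_oform 1.
have dv C : (p%:Z ^+ v %| C)%Z ->
    residues (2 * v) v.+1 (r0 + C) \subset residues (2 * v) v (r0 + 0).
  move=> pC; apply: (fintype.subset_trans (residuesS _ _ _)).
  apply/fintype.subsetP => r; rewrite !in_residues subr0.
  by rewrite [in X in X -> _]dvdz_addl // dvdzE abszN -dvdzE.
(* Of the p^v residues for which p^v divides c, two disjoint classes of p^(v-1) elements, one for
   each root, have larger valuation. *)
have -> : exact_residues (2 * v) r0 = residues (2 * v) v (r0 + 0) :\:
    (residues (2 * v) v.+1 (r0 + A) :|: residues (2 * v) v.+1 (r0 + B)).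
  apply/finset.setP => r; rewrite finset.in_setD finset.in_setU !in_residues subr0 inE /exact_dvd.
  by rewrite dvd_oform_double -[(2 * v).+1]addn1 E // addn1 andbC.
rewrite cardsD (finset.setIidPr _) ?finset.subUset ?dv // cardsU residues_disjoint; last first.
  by rewrite (_ : _ - _ = A - B) //; ring.
rewrite cards0 subn0.
have [e1 e2] : (2 * v = v + v.-1.+1)%N /\ (2 * v = v.+1 + v.-1)%N.
  by clear -v_gt0; lia.
rewrite (card_residues _ e1) !(card_residues _ e2).
by rewrite expnSr mulnBr muln2 addnn.
Qed.

Lemma card_exact_simple_root r0 m : (2 * v < m)%N ->
  #|exact_residues m r0| = (2 * totient (p ^ v))%N.
Proof.
move=> vm; pose j := (m - 2 * v)%N; have mE : m = (2 * v + j)%N by rewrite subnKC // ltnW.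
have j0 : (0 < j)%N by rewrite subn_gt0.
(* Exactness at 2 v + j also tests the exponent 2 v + j + 1, hence the precision j + 1. *)
have [A [B [pA pB AB E]]] := simple_root_oform j.+1.
have disj : residues m (v + j) (r0 + A) :&: residues m (v + j) (r0 + B) = finset.set0.
  apply: residues_disjoint; apply: contra AB => AB.
  rewrite (_ : A - B = r0 + A - (r0 + B)); last by ring.
  apply: dvdz_trans AB; apply: dvdz_exp2l.
  by rewrite -addn1 leq_add2l.
have exactE c : exact_dvd m c =
    ((p%:Z ^+ (v + j) %| c - A)%Z || (p%:Z ^+ (v + j) %| c - B)%Z) &&
    ~~ ((p%:Z ^+ (v + j).+1 %| c - A)%Z || (p%:Z ^+ (v + j).+1 %| c - B)%Z).
  by rewrite /exact_dvd mE -addnS !E // !addnS.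
have -> : exact_residues m r0 =
    (residues m (v + j) (r0 + A) :\: residues m (v + j).+1 (r0 + A)) :|:
    (residues m (v + j) (r0 + B) :\: residues m (v + j).+1 (r0 + B)).
  apply/finset.setP => r; have := congr1 (fun S : {set 'I_(p ^ m)} => r \in S) disj.
  have := fintype.subsetP (residuesS m (v + j) (r0 + A)) r.
  have := fintype.subsetP (residuesS m (v + j) (r0 + B)) r.
  rewrite finset.in_setU !finset.in_setD finset.in_setI finset.in_set0 !in_residues inE exactE.
  by do 4!case: (_ %| _)%Z => //= ; auto.
rewrite cardsU.
have -> : (residues m (v + j) (r0 + A) :\: residues m (v + j).+1 (r0 + A)) :&:
    (residues m (v + j) (r0 + B) :\: residues m (v + j).+1 (r0 + B)) = finset.set0.
  apply/finset.setP => r; have := congr1 (fun S : {set 'I_(p ^ m)} => r \in S) disj.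
  rewrite !finset.in_setI !finset.in_setD finset.in_set0.
  by do 2!case: (_ \in residues m (v + j) _); rewrite ?andbF.
rewrite cards0 subn0 !(@card_residuesD m (v + j) v) //; try by rewrite mE mul2n -addnn addnAC.
by rewrite totient_primeX // mul2n addnn.
Qed.

End SimpleRoot.

End Forms.
End Counting.

(** * The maximal order *)

(** Z is integrally closed in Q: the monic equation is carried to [algC], where rational algebraic
    integers are integers. *)
Lemma integral_base_int (L : fieldExtType rat) (x : L) :
  (x \in 1%VS) -> integralOver (intr : int -> L) x -> exists k : int, x = k%:~R.
Proof.
move=> /vlineP[q xE] [P Pmon]; rewrite {x}xE.
have -> : map_poly (intr : int -> L) P = map_poly (in_alg L) (map_poly intr P).
  by rewrite -map_poly_comp; apply: eq_map_poly => k /=; rewrite scaler_int.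
rewrite -[q *: 1]/(in_alg L q) fmorph_root => Pq.
have Aq : ratr q \in Aint.
  apply: (@root_monic_Aint (map_poly intr P)).
  - have -> : map_poly intr P = map_poly ratr (map_poly intr P : {poly rat}) :> {poly algC}.
      by rewrite -map_poly_comp; apply: eq_map_poly => k /=; rewrite ratr_int.
    by rewrite fmorph_root.
  - by rewrite monic_map.
  - by apply/polyOverP => i; rewrite coef_map /= rpred_int.
have /intrP[k kE] := Cint_rat_Aint (Crat_rat q) Aq.
exists k; rewrite -scaler_int; congr (_ *: 1).
by apply: (fmorph_inj (ratr : rat -> algC)) => /=; rewrite kE ratr_int.
Qed.

Lemma ext_rat_pchar (L : fieldExtType rat) (q : nat) : prime q -> q%:R != 0 :> L.
Proof.
move=> qP; rewrite -(rmorph_nat (in_alg L)) fmorph_eq0 pnatr_eq0.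
by case: q qP.
Qed.

Lemma galois_rat (L : splittingFieldType rat) : galois 1 {:L}.
Proof.
rewrite /galois sub1v normalFieldf andbT /=; apply/separableP => y _.
apply: contrapT => /negP/separablePn_pchar[q /andP[qP q0] _].
by move: (ext_rat_pchar L qP); rewrite q0.
Qed.

Section QuadraticField.
Variables (K : splittingFieldType rat) (d : int) (s : K).
Hypothesis hK : quadratic_field d s.

(** A rational [s] would be an integer k with d = k^2; then |k| <= 1 gives d = 0 or 1, and otherwise
    a prime factor of k contradicts squarefreeness. *)
Lemma sqrt_nonrat : s \notin 1%VS.
Proof.
have [d0 d1 dsf s2 _] := hK; apply/negP => s1.
have [] := integral_base_int s1.
  exists ('X^2 - d%:P); first exact: monicXnsubC.
  by rewrite rmorphB /= map_polyXn map_polyC /= rootE !hornerE s2 subrr.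
move=> k sE; have dE : d = k ^+ 2.
  have : in_alg K d%:~R = in_alg K (k ^+ 2)%:~R by rewrite /= !scaler_int -s2 sE rmorphXn.
  by move/fmorph_inj/eqP; rewrite eqr_int => /eqP.
have [k1|] := leqP `|k| 1.
  move: d0 d1; rewrite dE; case: k k1 {sE dE} => [[|[|]]|[|]] //.
move=> k1; move: (dsf _ (pdiv_prime k1)); rewrite dvdzE dE abszX absz_nat.
by rewrite dvdn_exp2r // pdiv_dvd.
Qed.

(** The Galois group has order 2, by X^2 - d and the irrationality of [s], so its norm and trace
    have only two terms. *)
Lemma quadratic_conj : exists g : {rmorphism K -> K},
  [/\ g s = - s, forall x, fieldNorm x = x * g x & forall x, galTrace 1 fullv x = x + g x].
Proof.
have [d0 d1 dsf s2 Kgen] := hK.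
have gal : galois 1 <<1; s>> by rewrite Kgen galois_rat.
have dim2 : #|'Gal(<<1; s>> / 1)%g| = 2.
  rewrite -(galois_dim gal) -adjoin_degreeE; apply/eqP; rewrite eqn_leq; apply/andP; split.
    rewrite -ltnS -size_minPoly.
    have sz : size ('X^2 - (d%:~R : K)%:P) = 3%N by rewrite size_XnsubC.
    rewrite -sz; apply: dvdp_leq; first by rewrite -size_poly_eq0 sz.
    apply: minPoly_dvdp; last by rewrite rootE !hornerE s2 subrr.
    by rewrite rpredB ?rpredX ?polyOverX // polyOverC rpred_int.
  by rewrite ltn_neqAle eq_sym adjoin_deg_eq1 sqrt_nonrat.
have /eqP/cards2P[a [b [ab GE]]] := dim2.
have [g G1 g1] : exists2 g : gal_of <<1; s>>,
    'Gal(<<1; s>> / 1)%g = [set (1%g : gal_of <<1; s>>); g]%SET & g != 1%g.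
  have : 1%g \in 'Gal(<<1; s>> / 1)%g by apply: fingroup.group1.
  rewrite GE !inE => /orP[] /eqP e; [exists b|exists a]; rewrite e //.
  - by rewrite eq_sym.
  - by rewrite finset.setUC.
have gG : g \in 'Gal(<<1; s>> / 1)%g by rewrite G1 !inE eqxx orbT.
have gs : g s = - s.
  have : g s ^+ 2 = s ^+ 2 by rewrite -rmorphXn s2 rmorph_int.
  move=> /eqP; rewrite eqf_sqr => /orP[|/eqP //].
  rewrite -[X in _ == X](gal_id <<1; s>> s) -gal_adjoin_eq ?fingroup.group1 //.
  by rewrite (negPf g1).
exists (g : 'AEnd(K)); split=> // x.
  rewrite /fieldNorm -Kgen /galNorm G1 big_setU1 /= ?inE 1?eq_sym //.
  by rewrite big_set1 gal_id.
rewrite -Kgen /galTrace G1 big_setU1 /= ?inE 1?eq_sym //.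
by rewrite big_set1 gal_id.
Qed.

Lemma sqrt_free (a b : int) : a%:~R + b%:~R * s = 0 :> K -> a = 0 /\ b = 0.
Proof.
move=> e; have intK_eq0 (k : int) : (k%:~R == 0 :> K) = (k == 0).
  by rewrite -scaler_int scaler_eq0 oner_eq0 orbF intr_eq0.
have b0 : b = 0.
  apply/eqP; apply: contraNT sqrt_nonrat => bn0.
  have -> : s = (- a%:~R / b%:~R : rat) *: 1.
    rewrite -[s](mulKf (x := b%:~R)) ?intK_eq0 //.
    rewrite -[_ * s](addKr a%:~R) e addr0.
    rewrite -[RHS]/(in_alg K _) fmorph_div rmorphN /= !scaler_int.
    by rewrite mulrC.
  by rewrite rpredZ // mem1v.
split=> //; move: e; rewrite b0 mul0r addr0 => /eqP.
by rewrite intK_eq0 => /eqP.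
Qed.

Lemma two_neq0 : (2 : K) != 0.
Proof. exact: (@ext_rat_pchar K 2). Qed.

Definition omega_trace : int := if (d %% 4 == 1)%Z then 1 else 0.
(** The division by 4 is exact in the branch where it occurs. *)
Definition omega_norm : int := if (d %% 4 == 1)%Z then ((1 - d) %/ 4)%Z else - d.

Let w := omega d s.

Lemma omega_sqr : w ^+ 2 = omega_trace%:~R * w - omega_norm%:~R.
Proof.
have [_ _ _ s2 _] := hK; have n2 := two_neq0.
rewrite /w /omega /omega_trace /omega_norm; case: ifP => [/eqP d1|_]; last first.
  by rewrite s2 mul0r sub0r rmorphN opprK.
have dE : d%:~R = 1 - 4 * ((1 - d) %/ 4)%Z%:~R :> K.
  have : d = 1 - 4 * ((1 - d) %/ 4)%Z by lia.
  by move=> {1}->; rewrite rmorphB rmorphM.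
rewrite expr_div_n sqrrD expr1n mul1r s2 dE; field.
by rewrite -[4%:R]/((2 * 2)%N%:R) natrM mulf_neq0 n2.
Qed.

Lemma omega_free (a b : int) : a%:~R + b%:~R * w = 0 :> K -> a = 0 /\ b = 0.
Proof.
have n2 := two_neq0.
rewrite /w /omega; case: ifP => [_|_]; last exact: sqrt_free.
move=> e; have : (2 * a + b)%:~R + b%:~R * s = 0 :> K.
  have -> : (2 * a + b)%:~R + b%:~R * s = 2 * (a%:~R + b%:~R * ((1 + s) / 2)).
    by rewrite rmorphD rmorphM; field.
  by rewrite e mulr0.
by move/sqrt_free => [h b0]; split=> //; lia.
Qed.

Lemma integral_quadratic (x : K) (u n : int) :
  x ^+ 2 = u%:~R * x - n%:~R -> integralOver (intr : int -> K) x.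
Proof.
move=> xE; have m : (('X - u%:P) * 'X : {poly int}) \is monic.
  by rewrite monicMl ?monicX ?monicXsubC.
exists (('X - u%:P) * 'X + n%:P).
  rewrite monicE lead_coefDl -?monicE //.
  by rewrite size_mulX ?polyXsubC_eq0 // size_XsubC (leq_ltn_trans (size_polyC_leq1 _)).
rewrite rootE rmorphD rmorphM rmorphB /= map_polyX !map_polyC !hornerE.
by apply/eqP; ring: xE.
Qed.

(** A prime factor of the denominator of [b] is prime to the numerator, so its square would divide
    [d]. *)
Lemma squarefree_sqr_int (b : rat) (m : int) :
  d%:~R * b ^+ 2 = m%:~R -> exists k : int, b = k%:~R.
Proof.
have [_ _ dsf _ _] := hK; move=> e; apply/intrP; rewrite Qint_def.
have e' : d * numq b ^+ 2 = m * denq b ^+ 2.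
  have den0 : (denq b)%:~R != 0 :> rat by rewrite intr_eq0 denq_neq0.
  have : d%:~R * (numq b)%:~R ^+ 2 = m%:~R * (denq b)%:~R ^+ 2 :> rat.
    by rewrite -e -[X in _ = _ * X ^+ 2 * _](divq_num_den b); field.
  by rewrite -!rmorphXn -!intrM => /intr_inj.
apply: contrapT => /negP den1.
have : (1 < `|denq b|)%N.
  by rewrite ltn_neqAle absz_gt0 denq_neq0 andbT eq_sym -eqz_nat gez0_abs ?denq_ge0.
move=> /pdiv_prime; set q := pdiv _ => qP; move: (dsf _ qP).
have -> : (q ^ 2)%N%:Z = q%:Z ^+ 2 by rewrite -rmorphXn.
have qb : (q%:Z %| denq b)%Z by rewrite dvdzE pdiv_dvd.
have : (q%:Z ^+ 2 %| d * numq b ^+ 2)%Z.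
  by rewrite e' dvdz_mull // dvdz_exp2r.
rewrite Gauss_dvdzl => [-> //|].
apply/coprimezXl/coprimezXr; rewrite prime_coprimez //; apply/negP => qa; have := coprime_num_den b.
move: qa qb; rewrite !dvdzE /coprime => qa qb /eqP g1.
have : (q %| 1)%N by rewrite -g1 dvdn_gcd qa qb.
by rewrite dvdn1 => /eqP q1; move: qP; rewrite q1.
Qed.

(** An integral x has integral trace A and norm N, and 2 x = A + B s with B rational. From d B^2 =
    A^2 - 4 N squarefreeness makes B an integer, and the same equation modulo 4 settles the
    parities. *)
Lemma O_K_omega : @O_K K = qorder w.
Proof.
have [d0 d1 dsf s2 Kgen] := hK; have n2 := two_neq0.
apply/seteqP; split=> x; last first.
  case/qorderP=> a [b ->]; apply: integral_add; first exact: (integral_id intr).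
  apply: integral_mul; first exact: (integral_id intr).
  exact: integral_quadratic omega_sqr.
move=> xint; have [g [gs gN gT]] := quadratic_conj.
have gal := galois_rat K.
have gint : integralOver (intr : int -> K) (g x).
  have [P Pm Px] := xint; exists P => //.
  have -> : map_poly intr P = map_poly g (map_poly intr P).
    by rewrite -map_poly_comp; apply: eq_map_poly => k /=; rewrite rmorph_int.
  by rewrite fmorph_root.
have [A AE] : exists A : int, x + g x = A%:~R.
  apply: integral_base_int; last exact: integral_add.
  by rewrite -gT; apply: (mem_galTrace gal); apply: memvf.
have [N NE] : exists N : int, x * g x = N%:~R.
  apply: integral_base_int; last exact: integral_mul.
  by rewrite -gN; apply: (mem_galNorm gal); apply: memvf.
have ggx : g (g x) = x.
  by apply: (addrI (g x)); rewrite -rmorphD AE rmorph_int -AE addrC.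
(* Both factors change sign under [g], so the product is half of its own trace, hence rational. *)
have [q qE] : exists q : rat, (x - g x) * s = q *: 1.
  apply/vlineP; have := mem_galTrace gal (memvf ((x - g x) * s)).
  rewrite gT rmorphM rmorphB gs ggx.
  have -> : (x - g x) * s + (g x - x) * - s = (2 : rat) *: ((x - g x) * s).
    by rewrite scaler_nat; ring.
  by move=> /(rpredZ (2^-1 : rat)); rewrite scalerA mulVf // scale1r.
have dr0 : d%:~R != 0 :> rat by rewrite intr_eq0.
have s0 : s != 0.
  by apply: contraNneq sqrt_nonrat => ->; rewrite mem0v.
have yE : x - g x = in_alg K (q / d%:~R) * s.
  apply: (mulIf s0); rewrite qE -mulrA -expr2 s2 -scaler_int -[_ *: 1]/(in_alg K _).
  by rewrite -[RHS]/(in_alg K _ * in_alg K _) -rmorphM divfK.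
have [B BE] : exists B : int, q / d%:~R = B%:~R.
  apply: (@squarefree_sqr_int _ (A ^+ 2 - 4 * N)).
  apply: (fmorph_inj (in_alg K)); rewrite rmorphM rmorphXn /= !scaler_int.
  have -> : d%:~R * ((q / d%:~R)%:A) ^+ 2 = (x - g x) ^+ 2.
    by rewrite yE exprMn s2 mulrC.
  have -> : (A ^+ 2 - 4 * N)%:~R = A%:~R ^+ 2 - 4 * N%:~R :> K by ring.
  by rewrite -AE -NE; ring.
rewrite BE /= scaler_int in yE.
have x2 : 2 * x = A%:~R + B%:~R * s by rewrite -AE -yE; ring.
have AB : A ^+ 2 - d * B ^+ 2 = 4 * N.
  apply: (@intr_inj rat); apply: (fmorph_inj (in_alg K)); rewrite /= !scaler_int.
  have -> : (A ^+ 2 - d * B ^+ 2)%:~R = A%:~R ^+ 2 - (B%:~R * s) ^+ 2 :> K.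
    by rewrite exprMn s2; ring.
  have -> : (4 * N)%:~R = 4 * N%:~R :> K by ring.
  by rewrite -yE -AE -NE; ring.
have d4 : (d %% 4)%Z <> 0.
  by move=> d4; move/negP: (dsf 2 isT); apply; apply/dvdz_mod0P.
have [a [i [AE' iE]]] : exists a i, A = 2 * a + i /\ (i = 0 \/ i = 1).
  by exists (A %/ 2)%Z, (A %% 2)%Z; lia.
have [b [j [BE' jE]]] : exists b j, B = 2 * b + j /\ (j = 0 \/ j = 1).
  by exists (B %/ 2)%Z, (B %% 2)%Z; lia.
(* A^2 = d B^2 modulo 4 with d nonzero modulo 4: equal parities if d is 1 modulo 4, both even
   otherwise. *)
have par : (d %% 4)%Z = 1 /\ i = j \/ (d %% 4)%Z <> 1 /\ i = 0 /\ j = 0.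
  move: AB; rewrite AE' BE'; clear -d4 iE jE.
  by case: iE => ->; case: jE => -> e; lia.
apply/qorderP; have inj2 u v : 2 * u = 2 * v -> u = v :> K by apply: mulfI.
rewrite /elt /w /omega; case: par => [[dm ij]|[/eqP/negPf dm [i0 j0]]].
  rewrite dm eqxx; exists (a - b), B; apply: inj2; rewrite x2 AE' BE' ij.
  by field.
rewrite dm; exists a, b; apply: inj2; rewrite x2 AE' BE' i0 j0.
by ring.
Qed.

(* Otherwise (a + omega) / p would be integral, but it is not in Z[omega]. *)
Lemma omega_double_root (p : nat) (a : int) : prime p ->
  (p%:Z %| 2 * a + omega_trace)%Z -> ~ (p%:Z ^+ 2 %| qform omega_trace omega_norm a 1)%Z.
Proof.
move=> pP /dvdzP[u uE] /dvdzP[m mE].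
have p0 := ext_rat_pchar K pP.
have : @O_K K ((a%:~R + w) / p%:R).
  apply: (@integral_quadratic _ u m).
  have aw : (a%:~R + w) ^+ 2 = u%:~R * p%:R * (a%:~R + w) - m%:~R * p%:R ^+ 2.
    rewrite -[p%:R]/(p%:Z%:~R) -rmorphXn -!intrM -uE -mE /qform.
    ring: omega_sqr.
  by rewrite expr_div_n aw; field.
rewrite O_K_omega => /qorderP[x [y e]].
have : elt w a 1 = p%:Z%:~R * elt w x y.
  by rewrite -e mulrC divfK // /elt mul1r.
rewrite eltZ => /(elt_inj omega_free)[_ py].
have : (p%:Z %| 1)%Z by apply/dvdzP; exists y; rewrite mulrC -py.
by rewrite dvdz1 absz_nat => /eqP p1; move: pP; rewrite p1.
Qed.

End QuadraticField.

(** * The order of conductor f *)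

(** Passage from cardinals of finite sets of residues to the relation [#=] on sets of ideals. *)
Lemma card_image_ord (T : Type) (N : nat) (S : {set 'I_N}) (F : nat -> T) :
  (forall i j, (i < N)%N -> (j < N)%N -> F i = F j -> i = j) ->
  [set q | exists2 i : 'I_N, i \in S & q = F i] #= `I_#|S|.
Proof.
move=> Finj; pose e := map val (enum S).
have sz : size e = #|S| by rewrite size_map -cardE.
have mem_e k : k \in e -> exists2 i : 'I_N, i \in S & k = i.
  by move=> /mapP[i]; rewrite mem_enum => iS ->; exists i.
have nthN k : (k < #|S|)%N -> exists2 i : 'I_N, i \in S & nth 0%N e k = i.
  by move=> kS; apply: mem_e; rewrite mem_nth ?sz.
have -> : [set q | exists2 i : 'I_N, i \in S & q = F i] = (F \o nth 0%N e) @` `I_#|S|.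
  apply/seteqP; split=> [_ [i iS ->]|_ [k kS <-]] /=; last first.
    by have [i iS ->] := nthN k kS; exists i.
  have ie : val i \in e by apply: map_f; rewrite mem_enum.
  by exists (index (val i) e); rewrite /= ?nth_index // -sz index_mem.
apply: inj_card_eq => j k; rewrite !inE /= => jS kS.
have [a _ ja] := nthN j jS; have [b _ kb] := nthN k kS.
rewrite ja kb => /(Finj _ _ (ltn_ord a) (ltn_ord b)); rewrite -ja -kb => /eqP.
by rewrite nth_uniq ?sz // => [/eqP //|]; rewrite map_inj_uniq ?enum_uniq //; apply: val_inj.
Qed.

Section Conductor.
Variables (K : splittingFieldType rat) (d : int) (s : K) (f p : nat).
Hypotheses (hK : quadratic_field d s) (hf : (2 <= f)%N) (hp : prime p) (hpf : (p %| f)%N).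

Let t0 := omega_trace d.
Let n0 := omega_norm d.
Let v := logn p f.
Let f' := (f %/ p ^ v)%N.
Let th : K := f%:R * omega d s.
Let t := f%:Z * t0.
Let n := f%:Z ^+ 2 * n0.

Lemma conductor_sqr : th ^+ 2 = t%:~R * th - n%:~R.
Proof. by rewrite /th /t /n exprMn (omega_sqr hK) -[f%:R]/(f%:Z%:~R); ring. Qed.

Lemma conductor_free (a b : int) : a%:~R + b%:~R * th = 0 :> K -> a = 0 /\ b = 0.
Proof.
rewrite /th mulrA -[f%:R]/(f%:Z%:~R) -intrM => /(omega_free hK)[-> /eqP].
rewrite mulf_eq0 => /orP[/eqP->//|/eqP f0].
by move: hf; case: f f0.
Qed.

Let thE := conductor_sqr.
Let th_free := conductor_free.

Let f_gt0 : (0 < f)%N.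
Proof. exact: ltnW. Qed.

Let v_gt0 : (0 < v)%N.
Proof. by rewrite -pfactor_dvdn // expn1. Qed.

Let fE : f%:Z = p%:Z ^+ v * f'%:Z.
Proof.
have : (p ^ v %| f)%N by apply: pfactor_dvdnn.
by move=> /divnK {1}<-; rewrite mulnC PoszM rmorphXn.
Qed.

Let p_f' : ~~ (p%:Z %| f'%:Z)%Z.
Proof.
rewrite dvdzE !absz_nat /f' /v; have [k kp fk] := pfactor_coprime hp f_gt0.
by rewrite {1}fk mulnK ?expn_gt0 ?prime_gt0 // -prime_coprime.
Qed.

Let pt : (p%:Z %| t)%Z.
Proof. by rewrite dvdz_mulr. Qed.

Let pn : (p%:Z ^+ 2 %| n)%Z.
Proof. by rewrite dvdz_mulr // dvdz_exp2r. Qed.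

Let p_dvd_n : (p%:Z %| n)%Z.
Proof. by apply: dvdz_trans pn; rewrite exprS dvdz_mulr. Qed.

(** The integer f omega - tau. For d = 1 modulo 4 it is (f - epsilon) / 2, an exact quotient since
    epsilon has the parity of f d, hence of f; otherwise epsilon = 0 and tau = f omega. *)
Definition tau_shift : int :=
  if (d %% 4 == 1)%Z then ((f%:Z - epsilon d f) %/ 2)%Z else 0.

Let r0 := tau_shift.
Let G (r : nat) : int := oform t0 n0 f (r%:Z - r0).

Lemma tauE : tau d s f = th - r0%:~R.
Proof.
have n2 := two_neq0 K.
rewrite /th /r0 /tau_shift /tau /omega /sqrt_d_K /epsilon /d_K.
case: ifP => [/eqP d1|_]; last first.
  have -> : ((f%:Z * (4 * d)) %% 2)%Z = 0 by clear; lia.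
  by field.
set e := ((f%:Z * d) %% 2)%Z.
have : (f%:Z - e) = 2 * ((f%:Z - e) %/ 2)%Z.
  rewrite /e (_ : d = 4 * (d %/ 4)%Z + 1); last by clear -d1; lia.
  by move: (d %/ 4)%Z => k; clear; lia.
move: ((f%:Z - e) %/ 2)%Z => k /(congr1 (intr : int -> K)); rewrite rmorphB rmorphM /=.
move=> h; have -> : e%:~R = f%:R - 2 * k%:~R :> K by rewrite -h; ring.
by field.
Qed.

Lemma latticeE l m (r : nat) : lattice d s f p l m r = lat th p l m (r%:Z - r0).
Proof.
rewrite /lattice /lat tauE.
by have -> : r%:R + (th - r0%:~R) = (r%:Z - r0)%:~R + th :> K by rewrite rmorphB /=; ring.
Qed.

Lemma dvd_normP m (r : nat) : dvd_norm d s f (p ^ m) r <-> (p%:Z ^+ m %| G r)%Z.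
Proof.
have n2 := two_neq0 K.
have NE : fieldNorm (r%:R + tau d s f) = (G r)%:~R.
  rewrite tauE; have -> : r%:R + (th - r0%:~R) = (r%:Z - r0)%:~R + th :> K.
    by rewrite rmorphB /=; ring.
  have [g [gs -> _]] := quadratic_conj hK.
  have gw : g (omega d s) = t0%:~R - omega d s.
    rewrite /omega /t0 /omega_trace; case: ifP => _; last by rewrite gs sub0r.
    by rewrite fmorph_div rmorphD rmorph1 gs rmorph_nat; field.
  rewrite /G; move: (r%:Z - r0) => c.
  rewrite rmorphD rmorph_int /th rmorphM rmorph_nat gw.
  rewrite /oform /qform -[f%:R]/(f%:Z%:~R).
  ring: (omega_sqr hK).
have pE : (p ^ m)%N%:R = (p%:Z ^+ m)%:~R :> K by rewrite natrX rmorphXn.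
rewrite /dvd_norm NE pE; split=> [[z]|/dvdzP[z ->]].
  by rewrite -intrM => /(qorder_intr_inj th_free) ->; rewrite dvdz_mulr.
by exists z; rewrite -intrM mulrC.
Qed.

Lemma P_fE : P_f d s f p = root_ideal th p 0.
Proof.
apply/seteqP; split=> [_ [a _ [b _ <-]]|_ [u [b [-> ]]]].
  by exists (p%:Z * a), b; split; [rewrite /elt intrM|rewrite mulr0 subr0 dvdz_mulr].
rewrite mulr0 subr0 => /dvdzP[a ->].
by exists a => //; exists b => //; rewrite /elt intrM mulrC.
Qed.

Lemma prime_splitsP : prime_splits K p <->
  exists a, (p%:Z %| qform t0 n0 a 1)%Z /\ ~ (p%:Z %| 2 * a + t0)%Z.
Proof.
rewrite /prime_splits (O_K_omega hK).
exact: (split_rootP (omega_sqr hK) (omega_free hK)).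
Qed.

Lemma prime_ramifies_root : prime_ramifies K p ->
  exists a, (p%:Z %| qform t0 n0 a 1)%Z /\ (p%:Z %| 2 * a + t0)%Z.
Proof.
rewrite /prime_ramifies (O_K_omega hK) => -[P].
exact: (ramified_root (omega_sqr hK) (omega_free hK)).
Qed.

Lemma prime_inert_noroot a : prime_inert K p -> ~ (p%:Z %| qform t0 n0 a 1)%Z.
Proof.
rewrite /prime_inert (O_K_omega hK).
exact: (inert_noroot (omega_sqr hK) (omega_free hK)).
Qed.

Lemma invertible_atomsE m : (0 < m)%N ->
  invertible_atoms_of_norm d s f p m =
  [set q | exists2 r : 'I_(p ^ m), r \in exact_residues p t0 n0 f m r0 & q = lattice d s f p 0 m r].
Proof.
move=> m0; have idP := lat_idealP thE th_free hp 0 m.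
apply/seteqP; split=> [q [[r rm ->] [idq _ _ _] inv _]|q [r]].
  move: idq inv; rewrite latticeE => /idP pm.
  move=> /(lat_invertible thE th_free hp 0 pm pt p_dvd_n)[m0'|npm].
    by rewrite m0' in m0.
  exists (Ordinal rm); last by rewrite latticeE.
  by rewrite inE /exact_dvd pm; apply/negP.
rewrite inE => /andP[pm npm] ->; rewrite /invertible_atoms_of_norm /= latticeE.
split; first by exists r; rewrite ?latticeE.
- by apply/(lat_atomP thE th_free hp pt pn) => //; left.
- by apply/(lat_invertible thE th_free hp 0 pm pt p_dvd_n); right; apply/negP.
- by have := lat_norm thE th_free hp 0 pm; rewrite muln0.
Qed.

Lemma card_invertible_atoms m : (0 < m)%N ->
  invertible_atoms_of_norm d s f p m #= `I_#|exact_residues p t0 n0 f m r0|.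
Proof.
move=> m0; rewrite invertible_atomsE //.
apply: (@card_image_ord _ _ _ (lattice d s f p 0 m)) => i j iN jN; rewrite !latticeE.
move=> /(lat_inj th_free hp)[_]; rewrite opprB addrA subrK => h.
by apply: small_dvdz_eq iN jN _; rewrite (_ : (p ^ m)%N%:Z = p%:Z ^+ m) // -rmorphXn.
Qed.

Local Notation O := (O_f d s f).
Local Notation P := (P_f d s f p).
Local Notation L := (lattice d s f p).
Local Notation A := (invertible_atoms_of_norm d s f p).

Lemma primary_lattice (q : set K) : is_ideal O q -> q <> O -> ideal_radical O q = P ->
  exists l m r : nat, [/\ (1 <= l + m)%N, (r < p ^ m)%N, dvd_norm d s f (p ^ m) r & q = L l m r].
Proof.
move=> idq qO radq.
have [_ [k _ qk]] : ideal_radical O q p%:R by rewrite radq P_fE; apply: root_ideal_p.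
have qk' : q (p%:Z ^+ k)%:~R by rewrite -pK_int.
have [l [m [c [lm pm qE]]]] := ideal_is_lat thE th_free hp idq qO qk'.
have pm0 : (0 < p ^ m)%N by rewrite expn_gt0 prime_gt0.
(* Since r + tau = (r - r0) + th, the residue must satisfy r - r0 = c modulo p^m. *)
have [r rm cr] := int_mod_nat (c + r0) pm0.
have pE : (p ^ m)%N%:Z = p%:Z ^+ m by rewrite -rmorphXn.
have qE' : q = L l m r.
  rewrite latticeE qE; apply: (lat_mod thE th_free).
  by rewrite opprB addrA -pE.
exists l, m, r; split=> //; apply/dvd_normP.
by apply/(lat_idealP thE th_free hp l); rewrite -latticeE -qE'.
Qed.

Lemma lattice_primary l m (r : nat) : (1 <= l + m)%N -> dvd_norm d s f (p ^ m) r ->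
  [/\ is_ideal O (L l m r), primary_ideal O (L l m r) & ideal_radical O (L l m r) = P].
Proof.
move=> lm /dvd_normP pm; rewrite latticeE P_fE; split.
- exact/(lat_idealP thE th_free hp).
- exact: (lat_primary thE th_free hp pt pn).
- exact: (lat_radical thE th_free hp pt pn).
Qed.

Lemma lattice_norm l m (r : nat) : dvd_norm d s f (p ^ m) r ->
  ideal_norm_is O (L l m r) (p ^ (2 * l + m)).
Proof. by move=> /dvd_normP pm; rewrite latticeE; apply: (lat_norm thE th_free hp). Qed.

Lemma lattice_invertible l m (r : nat) : dvd_norm d s f (p ^ m) r ->
  invertible_ideal O (L l m r) <-> m = 0%N \/ ~ dvd_norm d s f (p ^ m.+1) r.
Proof.
by move=> /dvd_normP pm; rewrite latticeE dvd_normP; apply: (lat_invertible thE th_free hp).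
Qed.

Lemma lattice_atom l m (r : nat) : (1 <= l + m)%N -> dvd_norm d s f (p ^ m) r ->
  ideal_atom O (L l m r) <-> l = 0%N \/ (l = 1%N /\ m = 0%N).
Proof.
by move=> lm /dvd_normP pm; rewrite latticeE; apply: (lat_atomP thE th_free hp pt pn).
Qed.

Lemma principal_lattice : principal_nat O p = L 1 0 0.
Proof.
rewrite latticeE (principal_nat_lat thE th_free); apply: (lat_mod thE th_free).
by rewrite expr0 dvd1z.
Qed.

Lemma dvd_norm1 r : dvd_norm d s f (p ^ 0) r.
Proof. by apply/dvd_normP; rewrite expr0 dvd1z. Qed.

Lemma primary_atom (q : set K) : is_ideal O q -> q <> O -> ideal_radical O q = P ->
  ideal_atom O q <-> q = principal_nat O p \/
    exists m r : nat, [/\ (1 <= m)%N, (r < p ^ m)%N, dvd_norm d s f (p ^ m) r & q = L 0 m r].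
Proof.
move=> idq qO radq; split.
  have [l [m [r [lm rm pm qE]]]] := primary_lattice idq qO radq.
  rewrite qE => /(lattice_atom lm pm) [l0|[l1 m0]].
    by right; exists m, r; rewrite l0 in lm *; split.
  left; rewrite principal_lattice l1 m0; congr lattice.
  by move: rm; rewrite m0 ltnS leqn0 => /eqP.
case=> [->|[m [r [m1 rm pm ->]]]].
  by rewrite principal_lattice; apply/lattice_atom; rewrite ?addn0 //; [apply: dvd_norm1|right].
by apply/lattice_atom => //; left.
Qed.

(** The trichotomy is stated by roots modulo p: this is the form in which a prime that does not
    split yields a bound on valuations. *)
Lemma prime_types : prime_splits K p \/
  (exists a, (p%:Z %| qform t0 n0 a 1)%Z /\ (p%:Z %| 2 * a + t0)%Z) \/
  (forall a, ~ (p%:Z %| qform t0 n0 a 1)%Z).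
Proof.
have [[a pa]|/forallNP] := pselect (exists a, (p%:Z %| qform t0 n0 a 1)%Z); last by right; right.
have [pa2|npa2] := pselect (p%:Z %| 2 * a + t0)%Z.
  by right; left; exists a.
by left; apply/prime_splitsP; exists a.
Qed.

Lemma nonsplit_bound m (r : nat) : ~ prime_splits K p -> dvd_norm d s f (p ^ m) r ->
  (m <= (2 * v).+1)%N.
Proof.
move=> nsplit /dvd_normP pm; rewrite leqNgt; apply/negP => vm.
have m2 : (1 < m - 2 * v)%N by rewrite ltn_subRL addn1.
have mE : (2 * v + (m - 2 * v) = m)%N by rewrite subnKC // ltnW // ltnW.
case: prime_types => [//|[[a [pa pa2]]|noroot]].
  have := double_root_oform2 hp fE p_f' v_gt0 pa pa2 (omega_double_root hK hp pa2) (r%:Z - r0) m2.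
  by rewrite mE => /negP; apply.
have := noroot_oform hp fE p_f' v_gt0 noroot (r%:Z - r0) (ltnW m2).
by rewrite mE => /negP; apply.
Qed.

Lemma nonsplit_finite : ~ prime_splits K p ->
  finite_set [set q | ideal_atom O q /\ ideal_radical O q = P].
Proof.
(* Atoms have l <= 1, and m <= 2 v + 1 when p does not split; thus all of them are indexed by a
   finite box. *)
move=> nsplit; set M := (2 * v).+2.
apply: (@sub_finite_set _ _ ((fun x => L x.1.1 x.1.2 x.2) @` (`I_2 `*` `I_M `*` `I_(p ^ M)))).
  move=> q [[idq q0 qO atq] radq].
  have [l [m [r [lm rm pm qE]]]] := primary_lattice idq qO radq.
  exists ((l, m), r) => //=.
  have mM : (m < M)%N by apply: nonsplit_bound pm.
  have rM : (r < p ^ M)%N.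
    by apply: leq_trans rm _; rewrite leq_exp2l ?prime_gt1 // ltnW.
  split=> //; split=> //=.
  have : ideal_atom O q by split.
  by rewrite qE => /(lattice_atom lm pm)[->|[->]].
by apply: finite_image; apply: finite_setX => //; apply: finite_setX.
Qed.

Lemma split_infinite : prime_splits K p ->
  ~ finite_set [set q | [/\ ideal_atom O q, invertible_ideal O q & ideal_radical O q = P]].
Proof.
move=> /prime_splitsP[a [pa npa2]] fin.
(* One invertible atom is chosen for each exponent from 2 v + 1 on, the norm telling them apart. The
   exponent 2 v is avoided, as its count p^(v-1) (p - 2) vanishes for p = 2. *)
have ex k : exists q, A ((2 * v).+1 + k)%N q.
  have m0 : (0 < (2 * v).+1 + k)%N by [].
  have vm : (2 * v < (2 * v).+1 + k)%N by rewrite addSn ltnS leq_addr.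
  have := card_invertible_atoms m0.
  rewrite (card_exact_simple_root hp fE p_f' v_gt0 pa npa2 _ vm) => cardA.
  apply/set0P/negP => /eqP A0; move: cardA; rewrite A0 card_eq_sym card_eq0 => /eqP e.
  have : `I_(2 * totient (p ^ v)) 0%N.
    by rewrite /= muln_gt0 totient_gt0 expn_gt0 (prime_gt0 hp).
  by rewrite e.
have [F FA] := choice ex.
apply: infinite_nat.
have -> : [set: nat] = F @^-1`
    [set q | [/\ ideal_atom O q, invertible_ideal O q & ideal_radical O q = P]].
  apply/seteqP; split=> // k _; have [[r rm qE] at_k inv_k _] := FA k; split=> //.
  have [idk _ _ _] := at_k; move: idk; rewrite qE latticeE.
  move=> /(lat_idealP thE th_free hp) pm; rewrite P_fE.
  exact: (lat_radical thE th_free hp pt pn).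
apply: finite_preimage fin => j k _ _ jk.
have [_ _ _ nj] := FA j; have [_ _ _ nk] := FA k.
move: nj nk; rewrite jk /ideal_norm_is card_eq_sym => nj nk.
have /card_eq_II/eqP := card_eq_trans nj nk.
by rewrite eqn_exp2l ?prime_gt1 // eqn_add2l => /eqP.
Qed.

Let card_atoms m k : (0 < m)%N -> #|exact_residues p t0 n0 f m r0| = k -> A m #= `I_k.
Proof. by move=> m0 <-; apply: card_invertible_atoms. Qed.

Lemma card_atoms_even h : (1 <= h)%N -> (h < v)%N -> A (2 * h)%N #= `I_(totient (p ^ h)).
Proof.
move=> h0 hv; apply: card_atoms; first by rewrite muln_gt0.
exact: (card_exact_even hp t0 n0 fE).
Qed.

Lemma card_atoms_odd m : odd m -> (m < 2 * v)%N -> A m #= `I_0.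
Proof.
by move=> om mv; apply: card_atoms; [case: m om mv|apply: (card_exact_odd hp t0 n0 fE)].
Qed.

Lemma card_atoms_inert : prime_inert K p ->
  A (2 * v)%N #= `I_(p ^ v) /\ forall m, (2 * v < m)%N -> A m #= `I_0.
Proof.
move=> inert; have noroot a := @prime_inert_noroot a inert.
split=> [|m vm]; apply: card_atoms; rewrite ?muln_gt0 //.
- exact: (card_exact_noroot_double hp fE p_f' v_gt0 noroot).
- exact: leq_ltn_trans vm.
- exact: (card_exact_noroot hp fE p_f' v_gt0 noroot).
Qed.

Lemma card_atoms_ramified : prime_ramifies K p ->
  [/\ A (2 * v)%N #= `I_(totient (p ^ v)), A (2 * v).+1 #= `I_(p ^ v)
    & forall m, ((2 * v).+1 < m)%N -> A m #= `I_0].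
Proof.
move=> /prime_ramifies_root[a [pa pa2]]; have npa := omega_double_root hK hp pa2.
split=> [||m vm]; apply: card_atoms; rewrite ?muln_gt0 //.
- exact: (card_exact_double_root_double hp fE p_f' v_gt0 pa pa2).
- exact: (card_exact_double_rootS hp fE p_f' v_gt0 pa pa2).
- exact: leq_ltn_trans vm.
- exact: (card_exact_double_root hp fE p_f' v_gt0 pa pa2 npa).
Qed.

Lemma card_atoms_split : prime_splits K p ->
  A (2 * v)%N #= `I_(p ^ v.-1 * (p - 2)) /\
  forall m, (2 * v < m)%N -> A m #= `I_(2 * totient (p ^ v)).
Proof.
move=> /prime_splitsP[a [pa npa2]].
split=> [|m vm]; apply: card_atoms; rewrite ?muln_gt0 //.
- exact: (card_exact_simple_root_double hp fE p_f' v_gt0 pa npa2).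
- exact: leq_ltn_trans vm.
- exact: (card_exact_simple_root hp fE p_f' v_gt0 pa npa2).
Qed.

End Conductor.

Theorem theorem3p6 (K : splittingFieldType rat) (d : int) (s : K) (f p : nat)
    (hK : quadratic_field d s) (hf : (2 <= f)%N)
    (hp : prime p) (hpf : (p %| f)%N) :
  let O := O_f d s f in
  let P := P_f d s f p in
  let v := logn p f in
  let L := lattice d s f p in
  let N_dvd := dvd_norm d s f in
  let A := invertible_atoms_of_norm d s f p in
  let is_inert := prime_inert K p in
  let is_split := prime_splits K p in
  let is_ramified := prime_ramifies K p in
  [/\ (* 1 *)
      (forall q : set K,
         (primary_ideal O q /\ ideal_radical O q = P) <->
         (exists l m r : nat,
            [/\ (1 <= l + m)%N, (r < p ^ m)%N, N_dvd (p ^ m)%N r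
              & q = L l m r])) /\
      (forall l m r : nat,
         (1 <= l + m)%N -> (r < p ^ m)%N -> N_dvd (p ^ m)%N r ->
         ideal_norm_is O (L l m r) (p ^ (2 * l + m))),
      (* 2; for m = 0 the ideal is p^l O, which is always invertible although
         the norm of tau may be divisible by p *)
      (forall l m r : nat,
         (1 <= l + m)%N -> (r < p ^ m)%N -> N_dvd (p ^ m)%N r ->
         (invertible_ideal O (L l m r) <->
          (m = 0%N \/ ~ N_dvd (p ^ m.+1)%N r))),
      (* 3 *)
      (forall q : set K, primary_ideal O q -> ideal_radical O q = P ->
         (ideal_atom O q <->
          (q = principal_nat O p \/
           exists m r : nat,
             [/\ (1 <= m)%N, (r < p ^ m)%N, N_dvd (p ^ m)%N r
               & q = L 0%N m r]))),
      (* 4 *)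
      [/\ forall h : nat, (1 <= h)%N -> (h < v)%N ->
            A (2 * h)%N #= `I_(totient (p ^ h)),
          [/\ is_inert -> A (2 * v)%N #= `I_(p ^ v),
              is_ramified -> A (2 * v)%N #= `I_(totient (p ^ v))
            & is_split -> A (2 * v)%N #= `I_(p ^ v.-1 * (p - 2))],
          [/\ is_inert -> A (2 * v).+1 #= `I_0,
              is_ramified -> A (2 * v).+1 #= `I_(p ^ v)
            & is_split -> A (2 * v).+1 #= `I_(2 * totient (p ^ v))],
          forall m : nat, ((2 * v).+1 < m)%N ->
            ((is_inert \/ is_ramified) -> A m #= `I_0) /\
            (is_split -> A m #= `I_(2 * totient (p ^ v)))
        & forall m : nat, odd m -> (m < 2 * v)%N -> A m #= `I_0]
    & (* 5 *)
      (finite_set [set q | ideal_atom O q /\ ideal_radical O q = P] <->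
       finite_set [set q | [/\ ideal_atom O q, invertible_ideal O q
                             & ideal_radical O q = P]]) /\
      (finite_set [set q | [/\ ideal_atom O q, invertible_ideal O q
                             & ideal_radical O q = P]] <->
       ~ is_split)].
Proof.
move=> O P v L N_dvd A is_inert is_split is_ramified.
have latP l m r := @lattice_primary K d s f p hK hf hp hpf l m r.
have inertP := card_atoms_inert hK hf hp hpf.
have ramifiedP := card_atoms_ramified hK hf hp hpf.
have splitP := card_atoms_split hK hf hp hpf.
split; [split|..].
- move=> q; split=> [[[idq qO _] radq]|[l [m [r [lm rm pm ->]]]]].
    exact: primary_lattice.
  by have [] := latP l m r lm pm.
- by move=> l m r _ _; apply: lattice_norm.
- by move=> l m r _ _; apply: lattice_invertible.
- by move=> q [idq qO _] radq; apply: primary_atom.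
- split.
  + by move=> h; apply: card_atoms_even.
  + split=> [/inertP|/ramifiedP|/splitP].
    * by case.
    * by case.
    * by case.
  + split=> [/inertP|/ramifiedP|/splitP].
    * by case=> // _; apply.
    * by case.
    * by case=> // _; apply.
  + move=> m vm; split=> [[/inertP|/ramifiedP]|/splitP].
    * by case=> // _; apply => //; apply: ltnW.
    * by case=> // _ _; apply.
    * by case=> // _; apply; apply: ltnW.
  + by move=> m; apply: card_atoms_odd.
have fin_sub : finite_set [set q | ideal_atom O q /\ ideal_radical O q = P] ->
    finite_set [set q | [/\ ideal_atom O q, invertible_ideal O q & ideal_radical O q = P]].
  by apply: sub_finite_set => q [].
have inf : finite_set [set q | [/\ ideal_atom O q, invertible_ideal O q
    & ideal_radical O q = P]] -> ~ is_split.
  by move=> fin /(split_infinite hK hf hp hpf).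
have fin : ~ is_split -> finite_set [set q | ideal_atom O q /\ ideal_radical O q = P].
  exact: nonsplit_finite.
split; split; [exact: fin_sub|by move/inf/fin|exact: inf|by move/fin/fin_sub].
Qed.
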